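(* Let $\mathbb T$ be a time scale, $X$ a finite-dimensional normed space, $A:\mathbb T\to\mathcal B(X)$ bounded and rd-continuous, and $a:\mathbb T\times X\to X$ rd-continuous in $t$ and continuous in $x$. Suppose the linear system $x^\Delta=A(t)x$ is hyperbolic on $\mathbb T$ with associated operator $\mathcal L$, and suppose there are constants $\lambda_0,\beta_0\ge0$ with $$\|a(t,x)\|\le\lambda_0\|x\|+\beta_0\quad\text{for all }t\in\mathbb T,\ x\in X,$$ and $\lambda_0\|\mathcal L\|<1$. Then the system $x^\Delta=A(t)x+a(t,x)$ has a bounded solution on $\mathbb T$.
   Context: A time scale $\mathbb T$ is a nonempty closed subset of $\mathbb R$; $t_-=\inf\mathbb T$, $t_+=\sup\mathbb T$; $\sigma(t)=\inf\{s\in\mathbb T:s>t\}$ (or $\sup\mathbb T$ if empty), $\mu(t)=\sigma(t)-t$. rd-continuous: continuous at right-dense points ($\mu(t)=0$), with finite left limits at left-dense points. $x^\Delta$ is the Hilger $\Delta$-derivative, $\int\cdot\,\Delta s$ the $\Delta$-integral, $E$ the identity, and $\Phi(t,s)$ the Cauchy operator of $x^\Delta=A(t)x$ ($\Phi(s,s)=E$). Hyperbolicity on $\mathbb T$: there is a continuous family of bounded projections $P(t),Q(t)$ on $X$, $t\in\mathbb T$, with $P(t)+Q(t)=E$, such that for every bounded rd-continuous $f:\mathbb T\to X$ the function $$\mathcal Lf(t)=\int_{t_-}^t\Phi(t,\sigma(s))P(s)f(s)\,\Delta s-\int_t^{t_+}\Phi(t,\sigma(s))Q(s)f(s)\,\Delta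 s$$ is a solution of $x^\Delta=A(t)x+f(t)$, and $\mathcal L$ is a bounded linear operator from $L^\infty(\mathbb T\to X)$ to $L^\infty(\mathbb T\to X)$ (sup norms); $\|\mathcal L\|$ denotes its operator norm.
   Formalization: ''a rd-continuous in t and continuous in x'' is taken in the stronger usual sense that t ↦ a(t,x(t)) is rd-continuous for every continuous x: T → X, and a(t,·) is continuous; with merely separate continuity the claim fails already for T = ℝ, X = ℝ, A = −1. *)

(* Defs.v *)
From HB Require Import structures.
From mathcomp Require Import all_boot all_order all_algebra.
From mathcomp Require Import all_classical all_reals all_analysis.
Set Implicit Arguments. Unset Strict Implicit. Unset Printing Implicit Defensive.
Import Order.TTheory GRing.Theory Num.Theory.
Import numFieldNormedType.Exports.
Local Open Scope classical_set_scope.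
Local Open Scope ring_scope.

Section TimeScale.
Context {R : realType}.

Definition time_scale (T : set R) : Prop := T !=set0 /\ closed T.

(* forward jump operator: sigma t = inf {s in T | s > t}, or sup T (= t) if empty *)
Definition fjump (T : set R) (t : R) : R :=
  if pselect (exists s, T s /\ t < s) then inf [set s | T s /\ t < s] else t.

Definition graininess (T : set R) (t : R) : R := fjump T t - t.

Definition left_dense (T : set R) (t : R) : Prop :=
  forall d : R, 0 < d -> exists s, T s /\ t - d < s /\ s < t.

(* T^kappa: T without a left-scattered maximum *)
Definition Tkappa (T : set R) (t : R) : Prop :=
  T t /\ ((exists s, T s /\ t < s) \/ left_dense T t).

End TimeScale.

Section Vec.
Context {R : realType} {X : normedModType R}.

Definition finite_dim : Prop :=
  exists (n : nat) (e : 'I_n -> X),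
    forall x : X, exists c : 'I_n -> R, x = \sum_(i < n) c i *: e i.

Definition bounded_on (T : set R) (f : R -> X) : Prop :=
  exists M : R, forall t, T t -> `|f t| <= M.

Definition cont_on (T : set R) (f : R -> X) : Prop :=
  forall t, T t -> forall e : R, 0 < e -> exists2 d : R, 0 < d &
    forall s, T s -> `|s - t| < d -> `|f s - f t| <= e.

Definition rd_cont (T : set R) (f : R -> X) : Prop :=
  forall t, T t ->
    (graininess T t = 0 -> forall e : R, 0 < e -> exists2 d : R, 0 < d &
        forall s, T s -> `|s - t| < d -> `|f s - f t| <= e) /\
    (left_dense T t -> exists l : X, forall e : R, 0 < e -> exists2 d : R, 0 < d &
        forall s, T s -> t - d < s -> s < t -> `|f s - l| <= e).

Definition has_dderiv (T : set R) (x : R -> X) (t : R) (d : X) : Prop :=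
  forall e : R, 0 < e -> exists2 del : R, 0 < del &
    forall s, T s -> `|t - s| < del ->
      `|x (fjump T t) - x s - (fjump T t - s) *: d| <= e * `|fjump T t - s|.

Definition dsolution (T : set R) (F : R -> X -> X) (x : R -> X) : Prop :=
  forall t, Tkappa T t -> has_dderiv T x t (F t (x t)).

Definition dantideriv (T : set R) (f G : R -> X) : Prop :=
  forall t, Tkappa T t -> has_dderiv T G t (f t).

Definition dint (T : set R) (f : R -> X) (a b : R) (v : X) : Prop :=
  exists G, dantideriv T f G /\ v = G b - G a.

Definition dint_from_inf (T : set R) (f : R -> X) (t : R) (v : X) : Prop :=
  if pselect (has_lbound T) then dint T f (inf T) t v
  else exists G, dantideriv T f G /\
    forall e : R, 0 < e -> exists N : R, forall a, T a -> a < N ->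
      `|(G t - G a) - v| <= e.

Definition dint_to_sup (T : set R) (f : R -> X) (t : R) (v : X) : Prop :=
  if pselect (has_ubound T) then dint T f t (sup T) v
  else exists G, dantideriv T f G /\
    forall e : R, 0 < e -> exists N : R, forall b, T b -> N < b ->
      `|(G b - G t) - v| <= e.

Definition supnorm (T : set R) (f : R -> X) : R := sup [set `|f t| | t in T].

Definition cauchy_op (T : set R) (A : R -> {linear X -> X})
    (Phi : R -> R -> {linear X -> X}) : Prop :=
  forall s, T s ->
    (forall xi, Phi s s xi = xi) /\
    (forall xi, dsolution T (fun t y => A t y) (fun t => Phi t s xi)).

Definition Lval (T : set R) (Phi : R -> R -> {linear X -> X})
    (P Q : R -> {linear X -> X}) (f : R -> X) (t : R) (v : X) : Prop :=
  exists v1 v2,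
    dint_from_inf T (fun s => Phi t (fjump T s) (P s (f s))) t v1 /\
    dint_to_sup T (fun s => Phi t (fjump T s) (Q s (f s))) t v2 /\
    v = v1 - v2.

Definition Lbound (T : set R) (Phi : R -> R -> {linear X -> X})
    (P Q : R -> {linear X -> X}) (K : R) : Prop :=
  forall f, bounded_on T f -> rd_cont T f ->
    forall g, (forall t, T t -> Lval T Phi P Q f t (g t)) ->
      supnorm T g <= K * supnorm T f.

Definition Lopnorm (T : set R) (Phi : R -> R -> {linear X -> X})
    (P Q : R -> {linear X -> X}) : R :=
  inf [set K | 0 <= K /\ Lbound T Phi P Q K].

Definition op_cont_at (T : set R) (P : R -> {linear X -> X}) (t : R) : Prop :=
  forall e : R, 0 < e -> exists2 d : R, 0 < d &
    forall s, T s -> `|s - t| < d -> forall x, `|P s x - P t x| <= e * `|x|.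

Definition hyperbolic (T : set R) (A : R -> {linear X -> X})
    (Phi : R -> R -> {linear X -> X}) (P Q : R -> {linear X -> X}) : Prop :=
  [/\ (forall t, T t -> forall x, P t (P t x) = P t x),
      (forall t, T t -> forall x, P t x + Q t x = x),
      (forall t, T t -> op_cont_at T P t),
      (forall f, bounded_on T f -> rd_cont T f ->
         exists g, (forall t, T t -> Lval T Phi P Q f t (g t)) /\
                   dsolution T (fun t y => A t y + f t) g /\ bounded_on T g) &
      (exists K, 0 <= K /\ Lbound T Phi P Q K)].

Definition op_rd_cont (T : set R) (A : R -> {linear X -> X}) : Prop :=
  forall t, T t ->
    (graininess T t = 0 -> op_cont_at T A t) /\
    (left_dense T t -> exists L : {linear X -> X}, forall e : R, 0 < e ->
       exists2 d : R, 0 < d & forall s, T s -> t - d < s -> s < t ->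
         forall x, `|A s x - L x| <= e * `|x|).

End Vec.

(* Main.v *)
Require Import Defs.
From HB Require Import structures.
From mathcomp Require Import all_boot all_order all_algebra.
From mathcomp Require Import all_classical all_reals all_analysis.
From mathcomp Require Import ring lra zify.
Set Implicit Arguments. Unset Strict Implicit. Unset Printing Implicit Defensive.
Import Order.TTheory GRing.Theory Num.Theory.
Import numFieldNormedType.Exports.
Local Open Scope classical_set_scope.
Local Open Scope ring_scope.

(** A bounded solution is a fixed point of [x |-> L (a (., x))]. With [K] an
    admissible bound for [L] such that [lambda0 * K < 1], this map preserves the
    bound [|x| <= r] as soon as [K * (lambda0 * r + beta0) <= r], and its values
    are equi-Lipschitz. Sampling at a finite net of [[- N, N]] and interpolating
    by a partition of unity turns the equation into a finite-dimensional one, for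
    which Brouwer's theorem gives approximate fixed points: solutions [x] of
    [x^Delta = A x + a (t, y)] with [|x - y|] small on [[- N, N]]. The pointwise
    limit of these along an ultrafilter is the solution. The sup-norm bound on
    [L] requires [a (t, .)] to be equicontinuous for [t] in a compact set; this
    follows from the rd-continuity of [a (., x (.))] along all continuous [x]. *)

(** * A discrete form of Brouwer's theorem *)

(** Schauder's theorem does not apply directly. On an unbounded [T] a bounded equi-Lipschitz family
    is relatively compact only for locally uniform convergence, whereas [Lbound] controls [L] only
    in the sup norm, and nothing makes [a t] equicontinuous uniformly over all of [T]. The way out
    is to let the approximants [y] vanish off a compact set that does not depend on their
    coefficients: two right-hand sides then differ only on that set, and their sup-norm distance is
    small. The limit is not taken inside the improper integrals defining [L] either, but in the
    dynamic equation, a local statement that survives pointwise limits of equi-Lipschitz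
    functions. *)

Section Kuhn.
Variable I : finType.
Implicit Types (q : {ffun I -> nat}) (f h : {ffun I -> nat} -> 'F_2).
Implicit Types (i j : I) (J : {set I}) (L : seq ({ffun I -> nat} -> 'F_2)).

Definition upd q j m : {ffun I -> nat} := [ffun i => if i == j then m else q i].
Definition shift j q := upd q j (q j).+1.
Definition delta j f q := f (shift j q) - f q.

(* The value on the unit cube at [q] with directions [J] of the cup product
   mod 2 of the coboundaries of the functions in [L]. *)
Fixpoint cup L J q : 'F_2 :=
  if L is h :: L' then
    \sum_(j in J) delta j h q * cup L' (J :\ j) (shift j q)
  else 1.

Lemma cup_cons h L J q :
  cup (h :: L) J q = \sum_(j in J) delta j h q * cup L (J :\ j) (shift j q).
Proof. by []. Qed.

Lemma F2_addxx (x : 'F_2) : x + x = 0.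
Proof. by rewrite -mulr2n -mulr_natl (_ : 2%:R = 0) ?mul0r//; apply/val_inj. Qed.

Lemma upd_upd q j m n : upd (upd q j m) j n = upd q j n.
Proof. by apply/ffunP => i; rewrite !ffunE; case: eqP. Qed.

Lemma updC q i j m n : i != j -> upd (upd q i m) j n = upd (upd q j n) i m.
Proof.
by move=> ij; apply/ffunP => k; rewrite !ffunE; case: eqP => // ->; rewrite eq_sym (negbTE ij).
Qed.

Lemma shift_upd q i j m : i != j -> shift j (upd q i m) = upd (shift j q) i m.
Proof.
by move=> ij; rewrite /shift updC// ffunE eq_sym (negbTE ij).
Qed.

Lemma shiftC i j q : shift i (shift j q) = shift j (shift i q).
Proof.
have [->//|ij] := eqVneq i j.
by rewrite {2}/shift shift_upd 1?eq_sym// /shift [upd q i _ j]ffunE eq_sym (negbTE ij).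
Qed.

(** Each unordered pair is counted twice, which cancels in characteristic 2; [lt] selects one order
    per pair. *)
Lemma F2_sum_sym J (g : I -> I -> 'F_2) : (forall i j, g i j = g j i) ->
  \sum_(i in J) \sum_(j in J :\ i) g i j = 0.
Proof.
move=> gC; pose lt i j := (enum_rank i < enum_rank j)%N.
have eqlt i : \sum_(j in J :\ i) g i j =
    \sum_(j in J | lt i j) g i j + \sum_(j in J | lt j i) g i j.
  rewrite (bigID (lt i))/=; congr (_ + _); apply: eq_bigl => j; rewrite !inE /lt.
    by case: eqVneq => [->|]; rewrite ?ltnn ?andbF.
  rewrite -leqNgt leq_eqVlt (inj_eq val_inj) (inj_eq enum_rank_inj).
  by case: eqVneq => [->|_]; rewrite ?ltnn ?andbF//= andbC.
rewrite (eq_bigr _ (fun i _ => eqlt i)) big_split/=.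
rewrite [X in _ + X](exchange_big_dep (mem J))/=; last by move=> i j _ /andP[].
rewrite -[RHS](F2_addxx (\sum_(i in J) \sum_(j in J | lt i j) g i j)); congr (_ + _).
apply: eq_bigr => j jJ; apply: eq_big => [i|i _]; last exact: gC.
by rewrite jJ.
Qed.

(** The coboundary of a product of coboundaries vanishes, without signs mod 2. The Leibniz rule
    gives a double sum of mixed second differences, symmetric in the two directions, and a rest
    killed by induction. *)
Lemma sum_delta_cup L J q : \sum_(j in J) delta j (cup L (J :\ j)) q = 0.
Proof.
elim: L J q => [|h L IH] J q; first by rewrite big1// => j _; rewrite /delta/= subrr.
pose g i j := delta j (delta i h) q * cup L (J :\ j :\ i) (shift i (shift j q)).
have gC i j : g i j = g j i.
  rewrite /g shiftC (_ : J :\ j :\ i = J :\ i :\ j); last by rewrite !finset.setDDl finset.setUC.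
  by rewrite /delta shiftC; congr (_ * _); ring.
have -> : \sum_(j in J) delta j (cup (h :: L) (J :\ j)) q =
  \sum_(j in J) \sum_(i in J :\ j) g j i +
  \sum_(i in J) delta i h q * \sum_(j in J :\ i) delta j (cup L (J :\ i :\ j)) (shift i q).
  under [X in _ + X]eq_bigr do rewrite mulr_sumr.
  rewrite [X in _ + X](exchange_big_dep (mem J))/=; last by move=> i j _; rewrite inE => /andP[].
  rewrite -big_split/=; apply: eq_bigr => j jJ.
  rewrite [X in _ + X](eq_bigl (mem (J :\ j))); last first.
    by move=> i; rewrite !inE jJ andbT andbC eq_sym.
  rewrite -big_split/= {1}/delta /= -sumrB; apply: eq_bigr => i _.
  rewrite gC /g /delta (shiftC i j) (_ : J :\ j :\ i = J :\ i :\ j); last first.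
    by rewrite !finset.setDDl finset.setUC.
  ring.
rewrite F2_sum_sym// add0r big1// => i _; by rewrite IH mulr0.
Qed.

(* The cup product is a coboundary, so summed over a grid it only depends on the
   boundary; with the boundary labels of [gsum_cup] a single face contributes,
   which gives the induction on the dimension. *)
Lemma cup_stokes h L J q :
  cup (h :: L) J q = \sum_(j in J) delta j (fun x => h x * cup L (J :\ j) x) q.
Proof.
have : h q * (\sum_(j in J) delta j (cup L (J :\ j)) q) = 0.
  by rewrite sum_delta_cup mulr0.
rewrite mulr_sumr => e0; rewrite cup_cons -[LHS]addr0 -[X in _ + X = _]e0 -big_split.
by apply: eq_bigr => j _ /=; rewrite /delta; ring.
Qed.

(** Expanded, [cup] is a sum over monotone lattice paths from [q] with distinct directions in [J],
    each term being the product of the increments of the functions in [L] along the successive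
    edges. A nonzero term forces each function to change along its edge. *)
Lemma cup_neq0 L J q : cup L J q != 0 -> forall h, h \in L ->
  exists (r : {ffun I -> nat}) j, [/\ j \in J, (forall i, q i <= r i <= q i + (i \in J))%N,
    r j = q j & h (shift j r) != h r].
Proof.
elim: L J q => //= h L IH J q /eqP H0 g.
have [j jJ /eqP] : exists2 j, j \in J & delta j h q * cup L (J :\ j) (shift j q) <> 0.
  apply: contrapT => H; apply: H0; rewrite big1// => j jJ.
  by apply: contrapT => H1; apply: H; exists j.
rewrite mulf_eq0 => /norP[d0 c0].
rewrite inE => /predU1P[->|gL].
  exists q, j; split=> //; last by rewrite -subr_eq0.
  by move=> i; rewrite leqnn leq_addr.
have [r [k [kJ qr rk gr]]] := IH _ _ c0 _ gL.
move: kJ; rewrite !inE => /andP[kj kJ].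
exists r, k; split=> //; last by rewrite rk ffunE (negbTE kj).
move=> i; have := qr i; rewrite !inE ffunE; have [->|] := eqVneq i j; rewrite /= ?jJ.
  by lia.
by [].
Qed.

Lemma cup_const h L J q : h \in L ->
  (forall r : {ffun I -> nat}, (forall i, i \notin J -> r i = q i) -> h r = h q) -> cup L J q = 0.
Proof.
move=> hL hc; apply/eqP; apply: contraT => /cup_neq0 /(_ _ hL)[r [j [jJ qr rj]]].
have rq i : i \notin J -> r i = q i.
  by move=> /negbTE iJ; have := qr i; rewrite iJ; lia.
rewrite (hc r)// hc ?eqxx// => i iJ; rewrite ffunE.
by case: (i =P j) => [ij|_]; [move: iJ; rewrite ij jJ|exact: rq].
Qed.

Variable p : nat.

(** Coordinates in [s] run over the grid and overwrite those of the argument; the others are kept,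
    so the sum over a face is the same sum over a shorter list. *)
Fixpoint gsum (s : seq I) f : {ffun I -> nat} -> 'F_2 :=
  if s is j :: s' then gsum s' (fun q => \sum_(m < p) f (upd q j m)) else f.

Lemma eq_gsum s f h : f =1 h -> gsum s f =1 gsum s h.
Proof.
elim: s f h => //= j s IH f h fh; apply: IH => q.
by apply: eq_bigr => m _; rewrite fh.
Qed.

Lemma gsumD s f h q : gsum s (fun x => f x + h x) q = gsum s f q + gsum s h q.
Proof.
elim: s f h q => //= j s IH f h q; rewrite -IH; apply: eq_gsum => x.
by rewrite big_split.
Qed.

Lemma gsum0 s q : gsum s (fun => 0) q = 0.
Proof.
elim: s q => //= j s IH q; rewrite -[RHS](IH q); apply: eq_gsum => x.
by rewrite big1.
Qed.

Lemma gsum_sum s (A : {set I}) (F : I -> {ffun I -> nat} -> 'F_2) q :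
  gsum s (fun x => \sum_(j in A) F j x) q = \sum_(j in A) gsum s (F j) q.
Proof.
rewrite (@eq_gsum _ _ (fun x => \sum_(j <- enum A) F j x)); last first.
  by move=> x; rewrite big_enum.
rewrite -[RHS]big_enum; elim: (enum A) => [|j e IH].
  rewrite big_nil -[RHS](gsum0 s q); apply: eq_gsum => x; exact: big_nil.
rewrite big_cons -IH; apply: etrans (gsumD _ _ _ _); apply: eq_gsum => x; exact: big_cons.
Qed.

Lemma gsum_upd s f j m q : j \notin s ->
  gsum s (fun x => f (upd x j m)) q = gsum s f (upd q j m).
Proof.
elim: s f q => //= i s IH f q; rewrite inE => /norP[ji js].
rewrite -(IH (fun x => \sum_(k < p) f (upd x i k)))//; apply: eq_gsum => x.
by apply: eq_bigr => k _; rewrite updC// eq_sym.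
Qed.

Lemma sum_delta_upd j f q :
  \sum_(m < p) delta j f (upd q j m) = f (upd q j p) - f (upd q j 0).
Proof.
elim: p => [|n IH]; first by rewrite big_ord0 subrr.
rewrite big_ord_recr/= IH /delta /shift upd_upd ffunE eqxx; ring.
Qed.

Lemma gsum_delta0 s j f q : j \in s ->
  (forall x : {ffun I -> nat}, x j = 0%N \/ x j = p -> f x = 0) -> gsum s (delta j f) q = 0.
Proof.
elim: s f q => //= i s IH f q jis f0.
have [ij|ij] := eqVneq j i.
  rewrite -ij -[RHS](gsum0 s q); apply: eq_gsum => x.
  by rewrite sum_delta_upd !f0 ?subrr// ffunE eqxx; [left|right].
have js : j \in s by move: jis; rewrite inE (negbTE ij).
rewrite -[RHS](IH (fun x => \sum_(m < p) f (upd x i m)) q js); last first.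
  move=> x xj; rewrite big1// => m _; apply: f0; by rewrite ffunE (negbTE ij).
apply: eq_gsum => x; rewrite /delta -sumrB; apply: eq_bigr => m _.
by rewrite shift_upd// eq_sym.
Qed.

Variable l : I -> {ffun I -> nat} -> 'F_2.
Hypothesis l0 : forall i q, q i = 0%N -> l i q = 0.
Hypothesis l1 : forall i q, q i = p -> l i q = 1.

Lemma gsum_cup s q : uniq s ->
  gsum s (cup [seq l i | i <- s] [set i in s]) q = 1.
Proof.
elim: s q => [//|j s IH] q; rewrite cons_uniq => /andP[js us].
have setE : [set i in j :: s] :\ j = [set i in s].
  apply/finset.setP => i; rewrite !inE; case: eqVneq => //= ->; by rewrite (negbTE js).
pose F i x := l j x * cup [seq l i | i <- s] ([set i in j :: s] :\ i) x.
rewrite (@eq_gsum _ _ (fun x => \sum_(i in [set i in j :: s]) delta i (F i) x)); last first.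
  by move=> x; rewrite map_cons cup_stokes.
rewrite gsum_sum (bigD1 j)/=; last by rewrite !inE eqxx.
(* In a direction i other than j, telescoping leaves the faces where coordinate i is 0 or p. There
   [l i] is constant but still occurs in the cup product, which therefore vanishes. *)
rewrite [X in _ + X]big1 ?addr0; last first.
  move=> i /andP[]; rewrite !inE => ijs ij.
  have {}ijs : i \in s by move: ijs; rewrite (negbTE ij).
  rewrite -[LHS]/(gsum (j :: s) (delta i (F i)) q).
  apply: gsum_delta0 => [|x xi]; first by rewrite inE ijs orbT.
  rewrite /F (@cup_const (l i)) ?mulr0//; first exact: map_f.
  move=> r rx; have ri : r i = x i by apply: rx; rewrite !inE eqxx.
  by case: xi => xi; [rewrite !l0// ri|rewrite !l1// ri].
(* In direction j the factor [l j] is 1 on the far face and 0 on the near one, leaving a grid sum of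
   one dimension less. *)
rewrite /= -(IH (upd q j p) us) -gsum_upd//; apply: eq_gsum => x.
rewrite sum_delta_upd /F l1 ?ffunE ?eqxx// l0 ?ffunE ?eqxx// setE.
by rewrite mul1r mul0r subr0.
Qed.

Lemma gsum_neq0 s f q : gsum s f q != 0 ->
  exists2 r : {ffun I -> nat}, f r != 0 & forall i, i \in s -> (r i < p)%N.
Proof.
elim: s f q => [|j s IH] f q /=; first by exists q.
move=> /IH[r /eqP r0 rs].
have [m m0] : exists m : 'I_p, f (upd r j m) <> 0.
  apply: contrapT => H; apply: r0; rewrite big1// => m _.
  by apply: contrapT => H1; apply: H; exists m.
exists (upd r j m) => [|i]; first exact/eqP.
rewrite inE ffunE; case: eqP => // _ /=; exact: rs.
Qed.

(** A cubical form of Sperner's lemma: the cup products over all cells add up to 1, so some cell has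
    a nonzero one, and on it every label takes both values. *)
Lemma kuhn : exists q : {ffun I -> nat}, (forall i, q i < p)%N /\
  forall i, exists r r' : {ffun I -> nat}, [/\ (forall k, q k <= r k <= (q k).+1)%N,
    (forall k, q k <= r' k <= (q k).+1)%N, l i r = 0 & l i r' = 1].
Proof.
have /gsum_neq0[q q0 qp] : gsum (enum I) (cup [seq l i | i <- enum I]
    [set i in enum I]) [ffun=> 0%N] != 0 by rewrite gsum_cup ?enum_uniq// oner_neq0.
exists q; split=> [i|i]; first by rewrite qp// mem_enum.
have F2_neq (x y : 'F_2) : x != y -> (x = 0 /\ y = 1) \/ (x = 1 /\ y = 0).
  move: x y; do 2 case => [[|[|//]] ?]; rewrite -val_eqE//= => _;
  [left|right]; by split; apply/val_inj.
have [|r [j [_ qr rj]]] := cup_neq0 q0 (h := l i).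
  by apply: map_f; rewrite mem_enum.
have r1 k : (q k <= r k <= (q k).+1)%N.
  have := qr k; by case: (_ \in _) => /=; lia.
have r2 k : (q k <= shift j r k <= (q k).+1)%N.
  by rewrite ffunE; case: eqP => // ->; rewrite rj; lia.
move=> /F2_neq[[h1 h2]|[h1 h2]]; first by exists (shift j r), r.
by exists r, (shift j r).
Qed.

End Kuhn.

(** Label i records the sign of [G u i - u i]. On a cell where every label takes both values, each
    component of [G u - u] is of either sign somewhere, hence small by uniform continuity. *)
Lemma approx_brouwer (R : realType) (I : finType) (G : (I -> R) -> I -> R) :
  (forall u : I -> R, (forall i, 0 <= u i <= 1) -> forall i, 0 <= G u i <= 1) ->
  (forall e : R, 0 < e -> exists2 d : R, 0 < d & forall u v : I -> R,
     (forall i, 0 <= u i <= 1) -> (forall i, 0 <= v i <= 1) ->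
     (forall i, `|u i - v i| <= d) -> forall i, `|G u i - G v i| <= e) ->
  forall e : R, 0 < e -> exists u : I -> R, (forall i, 0 <= u i <= 1) /\
    forall i, `|G u i - u i| <= e.
Proof.
move=> G01 Gc e e0; have e2 : 0 < e / 2 by rewrite divr_gt0.
have [d d0 Gd] := Gc _ e2.
pose d' := Num.min d (e / 2); have d'0 : 0 < d' by rewrite lt_min d0.
pose p := (Num.truncn d'^-1).+1.
have p0 : 0 < p%:R :> R by rewrite ltr0n.
have pd : p%:R^-1 <= d'.
  by rewrite -[leRHS]invrK lef_pV2 ?posrE ?invr_gt0// ltW// truncnS_gt.
pose pt (q : {ffun I -> nat}) i : R := (q i)%:R / p%:R.
(* The boundary values are imposed before the test: at coordinate p the strict comparison fails when
   [G] has value 1 there, yet [kuhn] needs label 1. *)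
pose l i (q : {ffun I -> nat}) : 'F_2 :=
  if q i == 0%N then 0 else if q i == p then 1 else if (G (pt q) i < pt q i)%R then 1 else 0.
have pt01 (q : {ffun I -> nat}) : (forall i, (q i <= p)%N) ->
    forall i, 0 <= pt q i <= 1.
  move=> qp i; rewrite /pt divr_ge0 ?ler0n//= ler_pdivrMr// mul1r ler_nat; exact: qp.
have [||q [qp qr]] := @kuhn I p l.
- by move=> i q; rewrite /l => ->.
- by move=> i q; rewrite /l => ->; rewrite eqxx.
have qp' i : (q i <= p)%N by exact: ltnW.
exists (pt q); split; first exact: pt01.
have near (r : {ffun I -> nat}) : (forall k, q k <= r k <= (q k).+1)%N ->
    [/\ forall i, 0 <= pt r i <= 1, forall i, `|pt q i - pt r i| <= e / 2 &
     forall i, `|G (pt q) i - G (pt r) i| <= e / 2].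
  move=> qr'; have rp i : (r i <= p)%N by have := qr' i; have := qp i; lia.
  have qrd i : `|pt q i - pt r i| <= d'.
    rewrite /pt -mulrBl normrM normfV normr_nat (le_trans _ pd)//.
    rewrite -[leRHS]mul1r ler_wpM2r ?invr_ge0 ?ler0n//.
    have : (r i = q i \/ r i = (q i).+1)%N by have := qr' i; lia.
    by case=> ->; rewrite ?subrr ?normr0 ?ler01// -natr1 opprD addNKr normrN1.
  split; [exact: pt01| |].
    by move=> i; rewrite (le_trans (qrd i))// ge_min lexx orbT.
  apply: Gd; [exact: pt01|exact: pt01|].
  by move=> i; rewrite (le_trans (qrd i))// ge_min lexx.
move=> i; have [r [r' [/near[r1 r2 r3] /near[r1' r2' r3'] lr lr']]] := qr i.
have Gr : pt r i <= G (pt r) i.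
  move: lr; rewrite /l; case: eqP => [r0 _|_].
    by rewrite /pt r0 mul0r; have /andP[] := G01 _ r1 i.
  case: eqP => // _; rewrite leNgt; by case: (_ < _).
have Gr' : G (pt r') i <= pt r' i.
  move: lr'; rewrite /l; case: eqP => // _.
  case: eqP => [rp _|_].
    by rewrite /pt rp divff ?gt_eqF//; have /andP[] := G01 _ r1' i.
  by case: ltP => // /ltW.
move: (r2 i) (r3 i) (r2' i) (r3' i); rewrite !ler_norml; lra.
Qed.

(** * Ultrafilter limits in finite dimension *)

Section UltraLimits.
Variables (R : realType) (U : set_system nat).
Hypothesis UU : UltraFilter U.

Lemma ultra_lim_real (u : nat -> R) (M : R) : (forall n, `|u n| <= M) ->
  exists l : R, forall e : R, 0 < e -> U [set n : nat | `|u n - l| <= e].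
Proof.
move=> uM.
have cM : compact (`[- M, M]%classic : set R) by exact: segment_compact.
have [|l [_ cl]] := cM (u @ U) _.
  rewrite /= /fmap/=; apply: filterS filterT => n _ /=.
  by rewrite in_itv/= -ler_norml.
exists l => e e0; case: (in_ultra_setVsetC [set n : nat | `|u n - l| <= e] UU) => // Un.
have := cl (u @` (~` [set n | `|u n - l| <= e])) (ball l e) _ (nbhsx_ballx _ _ e0).
case=> [|_ [[n /= ne <-]] ].
  by apply: (@filterS _ U _ _ _ _ Un) => n ne; exists n.
by rewrite /ball/= distrC => /ltW.
Qed.

End UltraLimits.

Section FiniteDim.
Variables (R : realType) (X : normedModType R).

(** A spanning family of least length is free: a relation with [c i] nonzero would allow [e i] to be
    eliminated. *)
Lemma finite_dim_free : @finite_dim R X -> exists (n : nat) (e : 'I_n -> X),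
  (forall x, exists c : 'I_n -> R, x = \sum_(i < n) c i *: e i) /\
  (forall c : 'I_n -> R, \sum_(i < n) c i *: e i = 0 -> forall i, c i = 0).
Proof.
move=> fd; pose span n := `[< exists e : 'I_n -> X,
  forall x, exists c : 'I_n -> R, x = \sum_(i < n) c i *: e i >].
have exn : exists n, span n by have [n [e h]] := fd; exists n; apply/asboolP; exists e.
case: (ex_minnP exn) => n /asboolP[e he] nmin; exists n, e; split=> // c c0 i.
apply: contrapT => /eqP ci; case: n e he nmin c c0 i ci => [|n] e he nmin c c0 i ci.
  by case: i ci.
suff /nmin : span n by rewrite ltnn.
apply/asboolP; exists (fun j => e (lift i j)) => x; have [d xd] := he x.
exists (fun j => d (lift i j) - d i / c i * c (lift i j)).
have -> : x = \sum_(j < n.+1) (d j - d i / c i * c j) *: e j.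
  under eq_bigr do rewrite scalerBl -scalerA.
  by rewrite sumrB -scaler_sumr c0 scaler0 subr0.
by rewrite (bigD1_ord i)//= divfK// subrr scale0r add0r.
Qed.

(** If no constant works, some coefficient families of l1 norm 1 have combinations tending to 0;
    their ultralimit is a relation, hence zero by freeness, against the normalisation. The bound
    covers arbitrary coefficients so that it applies to differences of coordinates without linearity
    of [k]. *)
Lemma finite_dim_coord : @finite_dim R X ->
  exists (n : nat) (e : 'I_n -> X) (k : X -> 'I_n -> R) (B : R),
  [/\ 0 < B, forall x, x = \sum_(i < n) k x i *: e i &
   forall (c : 'I_n -> R) i, `|c i| <= B * `|\sum_(i < n) c i *: e i| ].
Proof.
move=> /finite_dim_free[n [e [span free]]]; exists n, e.
have [k hk] := choice span; exists k; apply: contrapT => noB.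
have seqd (m : nat) : exists d : 'I_n -> R, \sum_(i < n) `|d i| = 1 /\
    `|\sum_(i < n) d i *: e i| <= m.+1%:R^-1.
  have B0 : 0 < m.+1%:R :> R by rewrite ltr0n.
  have [c [i ci]] : exists (c : 'I_n -> R) i,
      m.+1%:R * `|\sum_(i < n) c i *: e i| < `|c i|.
    apply: contrapT => H; apply: noB; exists m.+1%:R; split=> // c i.
    rewrite leNgt; apply/negP => ci; apply: H; by exists c, i.
  pose s := \sum_(i < n) `|c i|.
  have is_ : `|c i| <= s by rewrite /s (bigD1 i)//= lerDl sumr_ge0.
  have s0 : 0 < s by apply: lt_le_trans is_; apply: le_lt_trans ci; rewrite mulr_ge0.
  exists (fun j => s^-1 * c j); split.
    under eq_bigr do rewrite normrM gtr0_norm ?invr_gt0//.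
    by rewrite -mulr_sumr mulVf// gt_eqF.
  under eq_bigr do rewrite -scalerA.
  rewrite -scaler_sumr normrZ gtr0_norm ?invr_gt0// ler_pdivrMl//.
  rewrite -[leRHS]mulrC ler_pdivlMl//; apply: le_trans (ltW ci) is_.
have [d hd] := choice seqd.
have [U [UU oU]] := ultraFilterLemma (eventually_filter).
have d1 m i : `|d m i| <= 1.
  by have [<- _] := hd m; rewrite (bigD1 i)//= lerDl sumr_ge0.
have /choice[l hl] : forall i, exists l : R, forall e : R, 0 < e ->
    U [set m : nat | `|d m i - l| <= e].
  by move=> i; apply: (@ultra_lim_real _ _ _ _ 1) => m; exact: d1.
have hl' t : 0 < t -> U [set m | forall i, `|d m i - l i| <= t].
  by move=> t0; apply: filter_forall => i; exact: hl.
pose C := 1 + \sum_(i < n) `|e i|.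
have C0 : 0 < C by rewrite ltr_wpDr// sumr_ge0.
have l0 : \sum_(i < n) l i *: e i = 0.
  apply/eqP; rewrite -normr_le0; apply/ler_addgt0Pl => t t0; rewrite addr0.
  have t1 : 0 < t / 2 / C by rewrite !divr_gt0.
  have Um : U [set m | m.+1%:R^-1 <= t / 2].
    apply: oU; exists (Num.truncn (t / 2)^-1) => // m /= tm.
    rewrite -[leRHS]invrK lef_pV2 ?posrE ?invr_gt0 ?divr_gt0//.
    by rewrite ltW// (lt_le_trans (truncnS_gt _))// ler_nat.
  have [m [/= dl mt]] := filter_ex (filterI (hl' _ t1) Um).
  rewrite [t]splitr -[\sum_(i < n) _](subrK (\sum_(i < n) d m i *: e i)).
  apply: le_trans (ler_normD _ _) _; apply: lerD; last first.
    by apply: le_trans mt; have [] := hd m.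
  rewrite -sumrB (le_trans (ler_norm_sum _ _ _))//.
  apply: le_trans (_ : \sum_(i < n) t / 2 / C * `|e i| <= _).
    apply: ler_sum => i _; rewrite -scalerBl normrZ ler_wpM2r// distrC; exact: dl.
  by rewrite -mulr_sumr mulrAC ler_pdivrMr// ler_wpM2l ?divr_ge0 ?ltW// ltrDr.
have l00 := free _ l0.
pose D : R := 1 + n%:R; have D0 : 0 < D by rewrite ltr_wpDr.
have Di : 0 < D^-1 by rewrite invr_gt0.
have [m /= dl] := filter_ex (hl' _ Di).
have [d11 _] := hd m.
have : \sum_(i < n) `|d m i| <= \sum_(i < n) D^-1.
  by apply: ler_sum => i _; have := dl i; rewrite l00 subr0.
rewrite d11 sumr_const card_ord -mulr_natr mulrC ler_pdivlMr// mul1r.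
by rewrite leNgt ltrDr ltr01.
Qed.

Lemma ultra_lim (U : set_system nat) (u : nat -> X) (M : R) :
  @finite_dim R X -> UltraFilter U -> (forall n, `|u n| <= M) ->
  exists l, forall e : R, 0 < e -> U [set n : nat | `|u n - l| <= e].
Proof.
move=> /finite_dim_coord[n [e [k [B [B0 ek kB]]]]] UU uM.
have /choice[l hl] : forall i, exists l : R, forall e : R, 0 < e ->
    U [set m : nat | `|k (u m) i - l| <= e].
  move=> i; apply: (@ultra_lim_real _ _ _ _ (B * M)) => // m.
  by rewrite (le_trans (kB _ i))// -ek ler_wpM2l// ltW.
pose C := 1 + \sum_(i < n) `|e i|.
have C0 : 0 < C by rewrite ltr_wpDr// sumr_ge0.
exists (\sum_(i < n) l i *: e i) => t t0.
have tC : 0 < t / C by rewrite divr_gt0.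
have : U [set m | forall i, `|k (u m) i - l i| <= t / C].
  by apply: filter_forall => i; exact: hl.
apply: filterS => m /= hm.
rewrite {1}(ek (u m)) -sumrB (le_trans (ler_norm_sum _ _ _))//.
apply: le_trans (_ : \sum_(i < n) t / C * `|e i| <= _).
  apply: ler_sum => i _; rewrite -scalerBl normrZ ler_wpM2r//; exact: hm.
by rewrite -mulr_sumr mulrAC ler_pdivrMr// ler_wpM2l ?divr_ge0 ?ltW// ltrDr.
Qed.

End FiniteDim.

(** * Calculus on time scales *)

Lemma subrACA (V : zmodType) (a b c d : V) : a - b - (c - d) = a - c - (b - d).
Proof. by rewrite !opprD addrACA. Qed.

Section TimeScaleCalculus.
Variables (R : realType) (X : normedModType R) (T : set R).
Implicit Types (x y g : R -> X) (s t u : R).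

Lemma fjump_ge t : t <= fjump T t.
Proof.
rewrite /fjump; case: pselect => // -[s [Ts ts]].
by apply: lb_le_inf; [exists s|move=> u [Tu tu]; exact: ltW].
Qed.

Lemma fjump_le t s : T s -> t < s -> fjump T t <= s.
Proof.
move=> Ts ts; rewrite /fjump; case: pselect => [?|[]]; last by exists s.
by apply: ge_inf => //; exists t; move=> u [Tu tu]; exact: ltW.
Qed.

Lemma fjump_adherent t e : (exists s, T s /\ t < s) -> 0 < e ->
  exists s, [/\ T s, t < s & s < fjump T t + e].
Proof.
move=> ex e0; rewrite /fjump; case: pselect => // -[s0 s0P].
have hi : has_inf [set s | T s /\ t < s].
  by split; [exists s0|exists t; move=> u [Tu tu]; exact: ltW].
have [s [Ts ts] se] := inf_adherent e0 hi.
by exists s.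
Qed.

Hypothesis Tcl : closed T.

Lemma closed_adherent t : (forall e : R, 0 < e -> exists s, T s /\ `|t - s| < e) -> T t.
Proof.
move=> H; apply: Tcl => A /nbhs_ballP[e /= e0 eA].
by have [s [Ts st]] := H _ e0; exists s; split=> //; apply: eA.
Qed.

Lemma fjump_in t : T t -> T (fjump T t).
Proof.
move=> Tt; have [ex|nex] := pselect (exists s, T s /\ t < s); last first.
  by rewrite /fjump; case: pselect.
apply: closed_adherent => e e0.
have [s [Ts ts se]] := fjump_adherent ex e0; exists s; split=> //.
by rewrite distrC ger0_norm ?subr_ge0 ?fjump_le// ltrBlDl.
Qed.

Lemma has_dderivB x y t d d' : has_dderiv T x t d -> has_dderiv T y t d' ->
  has_dderiv T (fun s => x s - y s) t (d - d').
Proof.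
move=> xd yd e e0; have e2 : 0 < e / 2 by rewrite divr_gt0.
have [d1 d10 h1] := xd _ e2; have [d2 d20 h2] := yd _ e2.
exists (Num.min d1 d2); first by rewrite lt_min d10.
move=> s Ts; rewrite lt_min => /andP[s1 s2].
rewrite [X in X - _]subrACA scalerBr [X in `|X|]subrACA (le_trans (ler_normB _ _))//.
by rewrite [e]splitr mulrDl lerD ?h1 ?h2.
Qed.

Lemma has_dderiv_cont x t d : T t -> has_dderiv T x t d ->
  forall e : R, 0 < e -> exists2 del : R, 0 < del &
    forall s, T s -> `|s - t| < del -> `|x s - x t| <= e.
Proof.
move=> Tt xd e e0; have mu0 : 0 <= fjump T t - t by rewrite subr_ge0 fjump_ge.
set mu := fjump T t - t in mu0.
(* [x s - x t] is the difference of the derivative estimates at t and at s, plus [(s - t) *: d]. For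
   [|s - t|] below both 1 and e', these contribute at most e' mu, e' (mu + 1) and e' |d|. *)
pose C := 2 * mu + 1 + `|d|; have C0 : 0 < C by rewrite /C; have := normr_ge0 d; lra.
pose e' := e / C; have e'0 : 0 < e' by rewrite divr_gt0.
have [del del0 h] := xd _ e'0.
exists (Num.min (Num.min del 1) e'); first by rewrite !lt_min del0 e'0 ltr01.
move=> s Ts; rewrite !lt_min => /andP[/andP[sdel s1] se].
have h1 := h _ Tt; rewrite subrr normr0 in h1; have {}h1 := h1 del0.
have h2 := h _ Ts; rewrite distrC in h2; have {}h2 := h2 sdel.
have -> : x s - x t = x (fjump T t) - x t - (fjump T t - t) *: d -
    (x (fjump T t) - x s - (fjump T t - s) *: d) + (s - t) *: d.
  rewrite subrACA -scalerBl.
  rewrite (_ : fjump T t - t - (fjump T t - s) = s - t); last by ring.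
  by rewrite subrK opprB [RHS]addrC subrKA.
rewrite (le_trans (ler_normD _ _))// normrZ.
have := ler_normB (x (fjump T t) - x t - (fjump T t - t) *: d)
  (x (fjump T t) - x s - (fjump T t - s) *: d).
rewrite -/mu (ger0_norm mu0) in h1 *.
have h3 : `|fjump T t - s| <= mu + `|s - t|.
  by rewrite (_ : _ - s = mu - (s - t)) ?(le_trans (ler_normB _ _)) ?(ger0_norm mu0)// /mu; ring.
move=> h4.
have h5 : e' * `|fjump T t - s| <= e' * (mu + 1).
  by rewrite ler_wpM2l ?ltW// (le_lt_trans h3)// ltrD2l.
have h6 : `|s - t| * `|d| <= e' * `|d| by rewrite ler_wpM2r// ltW.
have eE : e = e' * (2 * mu + 1 + `|d|) by rewrite /e' divfK// gt_eqF.
rewrite [leRHS]eE; move: h1 h2 h4 h5 h6; lra.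
Qed.

(* Continuous induction: at the supremum of the set of points up to which the
   estimate holds, it extends further to the right unless the end is reached. *)
Lemma dderiv_norm_le g (d : R -> X) s t C : 0 <= C -> T s -> T t -> s <= t ->
  (forall u, Tkappa T u -> has_dderiv T g u (d u)) ->
  (forall u, T u -> s <= u -> u < t -> `|d u| <= C) ->
  `|g t - g s| <= C * (t - s).
Proof.
move=> C0 Ts Tt st gd dC; apply/ler_addgt0Pl => eps0 eps00.
have ts1 : 0 < t - s + 1 by lra.
pose e := eps0 / (t - s + 1); have e0 : 0 < e by rewrite divr_gt0.
apply: (@le_trans _ _ ((C + e) * (t - s))); last first.
  have : eps0 = e * (t - s + 1) by rewrite /e divfK// gt_eqF.
  lra.
pose S := [set u | [/\ T u, s <= u, u <= t & `|g u - g s| <= (C + e) * (u - s)]].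
have Ss : S s by split=> //; rewrite !subrr normr0 mulr0.
have hs : has_sup S by split; [exists s|exists t => u []].
pose m := sup S.
have Sm u : S u -> u <= m by move=> Su; apply: ub_le_sup => //; case: hs.
have mt : m <= t by apply: ge_sup; [exists s|move=> u []].
have sm : s <= m by exact: Sm.
have lft : ~ S m -> forall e' : R, 0 < e' -> exists u, [/\ S u, m - e' < u & u < m].
  move=> nSm e' e'0; have [u Su um] := sup_adherent e'0 hs; exists u; split=> //.
  rewrite lt_neqAle Sm// andbT; apply/eqP => um'; apply: nSm; by rewrite -um'.
have Tm : T m.
  have [[]//|/lft nSm] := pselect (S m); apply: closed_adherent => e' /nSm[u [[Tu _ _ _] mu um]].
  by exists u; split=> //; rewrite gtr0_norm ?subr_gt0//; lra.
have SSm : S m.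
  apply: contrapT => nSm; apply: (nSm); split=> //; apply/ler_addgt0Pl => e1 e10.
  have km : Tkappa T m.
    split=> //; right => e' e'0; have [u [[Tu _ _ _] mu um]] := lft nSm _ e'0.
    by exists u.
  have [del del0 hc] := has_dderiv_cont Tm (gd _ km) e10.
  have [u [[Tu su ut ug] mu um]] := lft nSm _ del0.
  have := hc _ Tu; rewrite ltr0_norm ?subr_lt0// => /(_ ltac:(lra)).
  rewrite distrC => h; have := ler_distD (g u) (g m) (g s).
  have : (C + e) * (u - s) <= (C + e) * (m - s) by rewrite ler_wpM2l//; lra.
  lra.
have [tm|mlt] := leP t m.
  by have -> : t = m; [apply/eqP; rewrite eq_le tm|case: SSm].
exfalso.
suff [u [Tu mu ut ug]] : exists u, [/\ T u, m < u, u <= t & `|g u - g m| <= (C + e) * (u - m)].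
  have : u <= m.
    apply: Sm; split=> //; first by lra.
    have [_ _ _ gm] := SSm; have := ler_distD (g m) (g u) (g s).
    lra.
  by rewrite leNgt mu.
have exm : exists s, T s /\ m < s by exists t.
have km : Tkappa T m by split=> //; left.
have [del del0 h] := gd _ km _ e0.
have dmC : `|d m| <= C by exact: dC.
(* From a right-scattered m the estimate extends to [fjump T m], using the derivative inequality at
   m itself; from a right-dense m, to a close point of [T] on the right. *)
have [jm|jm] := ltP m (fjump T m).
  exists (fjump T m); split; [exact: fjump_in|by []|exact: fjump_le|].
  have := h m Tm; rewrite subrr normr0 => /(_ del0).
  set w := g _ - g _; set z := _ *: _ => wz.
  rewrite -(subrK z w) (le_trans (ler_normD _ _))// /z normrZ.
  have j0 : 0 < fjump T m - m by rewrite subr_gt0.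
  have : (fjump T m - m) * `|d m| <= (fjump T m - m) * C by rewrite ler_wpM2l// ltW.
  move: wz; rewrite gtr0_norm//; lra.
have jme : fjump T m = m by apply/eqP; rewrite eq_le jm fjump_ge.
have dd0 : 0 < Num.min del (t - m) by rewrite lt_min del0 subr_gt0.
have [u [Tu mu]] := fjump_adherent exm dd0.
rewrite jme -ltrBlDl lt_min => /andP[ud ut].
exists u; split=> //; first by lra.
have := h u Tu; rewrite jme distrC gtr0_norm ?subr_gt0// => /(_ ud).
rewrite distrC.
rewrite (_ : _ - _ = (g u - g m) - (u - m) *: d m); last first.
  by rewrite opprB -(opprB u m) scaleNr addrC.
set w := g _ - g _; set z := _ *: _ => wz.
rewrite -(subrK z w) (le_trans (ler_normD _ _))// /z normrZ.
have j0 : 0 < u - m by rewrite subr_gt0.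
have : (u - m) * `|d m| <= (u - m) * C by rewrite ler_wpM2l// ltW.
rewrite (gtr0_norm j0); lra.
Qed.

Lemma dderiv_mean_value g (d : R -> X) s t C v : 0 <= C -> T s -> T t -> s <= t ->
  (forall u, Tkappa T u -> has_dderiv T g u (d u)) ->
  (forall u, T u -> s <= u -> u < t -> `|d u - v| <= C) ->
  `|g t - g s - (t - s) *: v| <= C * (t - s).
Proof.
move=> C0 Ts Tt st gd dC.
have := @dderiv_norm_le (fun u => g u - u *: v) (fun u => d u - v) s t C C0 Ts Tt st _ dC.
rewrite subrACA -scalerBl; apply => u ku; apply: has_dderivB; first exact: gd.
move=> e e0; exists 1 => // r _ _.
by rewrite -scalerBl subrr normr0 mulr_ge0// ltW.
Qed.

Lemma dderiv_lipschitz g (d : R -> X) C : 0 <= C ->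
  (forall u, Tkappa T u -> has_dderiv T g u (d u)) ->
  (forall u, T u -> `|d u| <= C) ->
  forall s t, T s -> T t -> `|g t - g s| <= C * `|t - s|.
Proof.
move=> C0 gd dC s t Ts Tt; wlog st : s t Ts Tt / s <= t => [H|].
  have /orP[st|ts] := le_total s t; first exact: H.
  by rewrite distrC (distrC t); exact: H.
rewrite ger0_norm ?subr_ge0//; apply: (@dderiv_norm_le g d) => // u Tu _ _.
exact: dC.
Qed.

End TimeScaleCalculus.

(** * Equicontinuity of the nonlinearity *)

Lemma inv_succ_small (R : realType) (e : R) : 0 < e ->
  exists n : nat, forall k : nat, (n <= k)%N -> k.+1%:R^-1 <= e.
Proof.
move=> e0; exists (Num.truncn e^-1) => k nk.
rewrite -[leRHS]invrK lef_pV2 ?posrE ?invr_gt0// ltW//.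
by rewrite (lt_le_trans (truncnS_gt _))// ler_nat.
Qed.

Section Hat.
Variables (R : realType) (c h : R).

Definition hat (v : R) : R := Num.max 0 (h - `|v - c|).

Lemma hat_ge0 v : 0 <= hat v.
Proof. by rewrite /hat le_max lexx. Qed.

Lemma hat_gt0 v : (0 < hat v) = (`|v - c| < h).
Proof. by rewrite /hat lt_max ltxx subr_gt0. Qed.

Lemma hat_lipschitz u v : `|hat v - hat u| <= `|v - u|.
Proof.
have h1 : h - `|v - c| <= h - `|u - c| + `|v - u|.
  have := ler_distD v u c; rewrite (distrC u v); lra.
have h2 : h - `|u - c| <= h - `|v - c| + `|v - u| by have := ler_distD u v c; lra.
have p := normr_ge0 (v - u).
rewrite ler_distlC /hat; apply/andP; split.
  rewrite lerBlDr ge_max; apply/andP; split.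
    by rewrite ler_wpDr// le_max lexx.
  by rewrite (le_trans h1)// lerD2r le_max lexx orbT.
rewrite ge_max; apply/andP; split; first by rewrite ler_wpDr// le_max lexx.
by rewrite (le_trans h2)// lerD2r le_max lexx orbT.
Qed.

End Hat.

Section Interpolation.
Variables (R : realType) (X : normedModType R).

(** The distances to t shrink by a factor 4, so the tents of radius [rho k / 4] around the [s k]
    have disjoint supports. The function is [x] plus the normalised tents times [y k - x]; it is
    continuous as a uniform limit of the Lipschitz partial sums [S m]. *)
Lemma interpolate (t : R) (s : nat -> R) (x : X) (y : nat -> X) :
  (forall k, 0 < `|s k - t|) -> (forall k, `|s k.+1 - t| <= `|s k - t| / 4) ->
  (forall e : R, 0 < e -> exists n, forall k, (n <= k)%N -> `|y k - x| <= e) ->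
  exists w : R -> X, (forall k, w (s k) = y k) /\
    forall u (e : R), 0 < e -> exists2 d : R, 0 < d &
      forall v, `|v - u| < d -> `|w v - w u| <= e.
Proof.
move=> rho0 rhoS yx; pose rho k := `|s k - t|.
have rho_lt j k : (k < j)%N -> rho j <= rho k / 4.
  elim: j => // j IH; rewrite ltnS leq_eqVlt => /predU1P[->|/IH kj]; first exact: rhoS.
  have := rhoS j; have := rho0 j; rewrite -!/(rho _); lra.
pose c k v := hat (s k) (rho k / 4) v / (rho k / 4).
have r4 k : 0 < rho k / 4 by rewrite divr_gt0//; exact: rho0.
have c0 k v : 0 <= c k v by rewrite divr_ge0 ?hat_ge0// ltW.
have c1 k v : c k v <= 1.
  rewrite ler_pdivrMr// mul1r /hat ge_max ltW//=.
  by rewrite lerBlDr lerDl.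
have disj k j v : 0 < c k v -> j != k -> c j v = 0.
  have far i : 0 < c i v -> `|v - s i| < rho i / 4.
    by rewrite pmulr_lgt0 ?invr_gt0// hat_gt0.
  have sep i i' : (i < i')%N -> 0 < c i v -> 0 < c i' v -> False.
    move=> /rho_lt ii' /far h1 /far h2.
    have := ler_distD v (s i) t; rewrite -/(rho i) (distrC (s i)).
    have := ler_distD (s i') v t; rewrite -/(rho i').
    have := rho0 i; rewrite -/(rho i); lra.
  move=> ck jk; apply/eqP; rewrite eq_le c0 andbT leNgt; apply/negP => cj.
  by move: jk; rewrite neq_ltn => /orP[jk|kj]; [exact: (sep j k)|exact: (sep k j)].
pose w v := if pselect (exists k, 0 < c k v) is left ex
  then x + c (projT1 (cid ex)) v *: (y (projT1 (cid ex)) - x) else x.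
pose S m v := x + \sum_(k < m) c k v *: (y k - x).
have wk k v : 0 < c k v -> w v = x + c k v *: (y k - x).
  move=> ck; rewrite /w; case: pselect => [ex|[]]; last by exists k.
  case: (cid ex) => j /= cj; have [->//|jk] := eqVneq j k.
  by move: cj; rewrite (disj _ _ _ ck jk) ltxx.
have wS m (e : R) : 0 <= e -> (forall k, (m <= k)%N -> `|y k - x| <= e) ->
    forall v, `|w v - S m v| <= e.
  move=> e0 ye v; have [[k ck]|nk] := pselect (exists k, 0 < c k v); last first.
    rewrite /w; case: pselect => // _; rewrite /S big1 ?addr0 ?subrr ?normr0// => k _.
    suff -> : c k v = 0 by rewrite scale0r.
    by apply/eqP; rewrite eq_le c0 andbT leNgt; apply/negP => ck; apply: nk; exists k.
  rewrite (wk _ _ ck) /S; have [km|mk] := ltnP k m.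
    rewrite (bigD1 (Ordinal km))//= big1 ?addr0 ?subrr ?normr0// => j jk.
    by rewrite (disj _ _ _ ck) ?scale0r//.
  rewrite big1 ?addr0; last first.
    move=> j _; rewrite (disj _ _ _ ck) ?scale0r// neq_ltn.
    by rewrite (leq_trans (ltn_ord j) mk).
  rewrite addrC addKr normrZ ger0_norm// (le_trans _ (ye _ mk))//.
  by rewrite -[leRHS]mul1r ler_wpM2r.
have SL m : exists2 L : R, 0 < L & forall u v, `|S m v - S m u| <= L * `|v - u|.
  exists (1 + \sum_(k < m) (rho k / 4)^-1 * `|y k - x|).
    by rewrite ltr_wpDr// sumr_ge0// => k _; rewrite mulr_ge0// invr_ge0 ltW.
  move=> u v; rewrite /S opprD addrACA subrr add0r -sumrB mulrDl mul1r mulr_suml.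
  rewrite (le_trans (ler_norm_sum _ _ _))// ler_wpDl//.
  apply: ler_sum => k _; rewrite -scalerBl normrZ mulrAC ler_wpM2r//.
  rewrite /c -mulrBl normrM [X in _ * X]gtr0_norm ?invr_gt0// [leRHS]mulrC.
  by rewrite ler_wpM2r ?invr_ge0 ?hat_lipschitz// ltW.
exists w; split=> [k|u e e0].
  have c1k : c k (s k) = 1.
    by rewrite /c /hat subrr normr0 subr0 max_r ?ltW// divff// gt_eqF.
  by rewrite (wk k) c1k// scale1r addrC subrK.
have e3 : 0 < e / 3 by rewrite divr_gt0.
have [m ym] := yx _ e3; have wSe := wS m _ (ltW e3) ym.
have [L L0 SLm] := SL m; exists (e / 3 / L) => [|v]; first by rewrite divr_gt0.
rewrite ltr_pdivlMr// => vu.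
have := SLm u v; rewrite mulrC => h1.
have := wSe v; have := wSe u; rewrite distrC => h2 h3.
have := ler_distD (S m v) (w v) (w u); have := ler_distD (S m u) (S m v) (w u).
lra.
Qed.

End Interpolation.

Section EquicontinuousNonlinearity.
Variables (R : realType) (X : normedModType R) (T : set R) (a : R -> X -> X).
Hypothesis a_rd : forall x : R -> X, cont_on T x -> rd_cont T (fun t => a t (x t)).
Hypothesis a_cont : forall t, T t -> continuous (a t).

(* Along a fast sequence of counterexamples [(s_k, y_k)] one interpolates
   continuously between [y_k] (k even) and the constant [x] (k odd); [a] has a
   limit along this function and along [x], and both limits agree. *)
Lemma equicont_one_sided (side : R -> Prop) (t : R) (x : X) (e : R) : 0 < e ->
  (forall s, side s -> s != t) ->
  (forall f : R -> X, rd_cont T f ->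
     (forall d : R, 0 < d -> exists s, [/\ T s, side s & `|s - t| < d]) ->
     exists l, forall e : R, 0 < e -> exists2 d : R, 0 < d &
       forall s, T s -> side s -> `|s - t| < d -> `|f s - l| <= e) ->
  exists2 d : R, 0 < d & forall s y, T s -> side s -> `|s - t| < d ->
    `|y - x| < d -> `|a s y - a s x| <= e.
Proof.
move=> e0 side_neq side_lim; apply: contrapT => H.
have bad (d : R) : exists p : R * X, 0 < d -> [/\ T p.1, side p.1, `|p.1 - t| < d,
    `|p.2 - x| < d & e < `|a p.1 p.2 - a p.1 x| ].
  apply: contrapT => H1; have d0 : 0 < d.
    by rewrite ltNge; apply/negP => d0; apply: H1; exists (0, 0); rewrite ltNge d0.
  apply: H; exists d => // s y Ts ss sd yd; rewrite leNgt; apply/negP => ey.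
  by apply: H1; exists (s, y).
have [F hF] := choice bad.
(* Each new radius is a quarter of the distance from the last point to t, which yields the decay
   required by [interpolate]. *)
pose dl k := iter k (fun d => `|(F d).1 - t| / 4) 1.
have dl0 k : 0 < dl k.
  elim: k => [|k IH]; first exact: ltr01.
  have [_ /side_neq st _ _ _] := hF _ IH.
  by rewrite /= divr_gt0// normr_gt0 subr_eq0.
have hs k := hF _ (dl0 k).
pose s k := (F (dl k)).1; pose y k := (F (dl k)).2.
have dlS k : dl k.+1 = `|s k - t| / 4 by [].
have dl_small k : dl k <= k.+1%:R^-1.
  elim: k => [|k IH]; first by rewrite invr1.
  have [_ _ h _ _] := hs k; rewrite -/(s k) in h.
  rewrite dlS; apply: (@le_trans _ _ (k.+1%:R^-1 / 4)).
    by rewrite ler_wpM2r// (le_trans (ltW h)).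
  rewrite -invfM lef_pV2 ?posrE ?mulr_gt0//; rewrite -natrM ler_nat; lia.
pose y' k := if odd k then x else y k.
have [k|k|d d0|w [ws wc]] := @interpolate _ _ t s x y'.
- by have := dl0 k.+1; rewrite dlS pmulr_lgt0.
- by have [_ _ h _ _] := hs k.+1; rewrite -dlS ltW.
- have [n hn] := inv_succ_small d0; exists n => k nk; rewrite /y'.
  case: odd; first by rewrite subrr normr0 ltW.
  have [_ _ _ h _] := hs k.
  by rewrite (le_trans (ltW h))// (le_trans (dl_small _))// hn.
have wT : cont_on T w.
  move=> u _ d d0; have [d1 d10 h] := wc u d d0; exists d1 => // v _; exact: h.
have xT : cont_on T (fun=> x).
  by move=> u _ d d0; exists 1 => // v _ _; rewrite subrr normr0 ltW.
have near_t (d : R) : 0 < d -> exists n, forall k, (n <= k)%N -> `|s k - t| < d.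
  move=> d0; have d2 : 0 < d / 2 by rewrite divr_gt0.
  have [n hn] := inv_succ_small d2; exists n => k nk; have [_ _ h _ _] := hs k.
  rewrite (lt_le_trans h)// (le_trans (dl_small _))// (le_trans (hn _ nk))//; lra.
have acc (d : R) : 0 < d -> exists s, [/\ T s, side s & `|s - t| < d].
  move=> /near_t[n hn]; exists (s n); have [Ts ss _ _ _] := hs n; split=> //.
  exact: hn.
have [l1 hl1] := side_lim _ (a_rd wT) acc; have [l2 hl2] := side_lim _ (a_rd xT) acc.
have e4 : 0 < e / 4 by rewrite divr_gt0.
have [d1 d10 {}hl1] := hl1 _ e4; have [d2 d20 {}hl2] := hl2 _ e4.
have [n1 hn1] := near_t _ d10; have [n2 hn2] := near_t _ d20.
pose n := ((n1 + n2).*2)%N.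
have big1 : (n1 <= n)%N by rewrite /n; lia.
have big2 : (n2 <= n)%N by rewrite /n; lia.
have [Tn sn _ _ en] := hs n; have [TSn sSn _ _ _] := hs n.+1.
have := hl1 _ Tn sn (hn1 _ big1); have := hl2 _ Tn sn (hn2 _ big2).
have := hl1 _ TSn sSn (hn1 _ (leqW big1)); have := hl2 _ TSn sSn (hn2 _ (leqW big2)).
have yn : y' n = y n by rewrite /y' /n odd_double.
have ySn : y' n.+1 = x by rewrite /y' /n oddS odd_double.
rewrite -!/(s _) !ws yn ySn => h1 h2 h3 h4.
move: en; rewrite -/(s n) -/(y n) => en.
(* The chain [a (s n) (y n)], [l1], [a (s n.+1) x], [l2], [a (s n) x] has four links of length at
   most e / 4, against [en]. *)
have := ler_distD l1 (a (s n) (y n)) (a (s n) x).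
have := ler_distD (a (s n.+1) x) l1 (a (s n) x); rewrite (distrC l1 (a (s n.+1) x)).
have := ler_distD l2 (a (s n.+1) x) (a (s n) x); rewrite (distrC l2).
lra.
Qed.

Hypothesis Tcl : closed T.

(** The comparison is with [a s x] and not [a t x], since [a] may jump in time at a left-dense
    point. Accumulation from the right means zero graininess, from the left left-density, and
    rd-continuity supplies a one-sided limit in each case. *)
Lemma equicont_at (t : R) (x : X) (e : R) : T t -> 0 < e ->
  exists2 d : R, 0 < d & forall s y, T s -> `|s - t| < d ->
    `|y - x| < d -> `|a s y - a s x| <= e.
Proof.
move=> Tt e0.
have [d0 d00 h0] : exists2 d : R, 0 < d & forall y, `|y - x| < d -> `|a t y - a t x| <= e.
  have /cvgrPdist_le/(_ e e0) := a_cont Tt (x := x).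
  move=> /nbhs_ballP[d /= d0 hd]; exists d => // y yx; rewrite distrC; apply: hd.
  by rewrite -ball_normE /= distrC.
have [|f fr acc|d1 d10 h1] := @equicont_one_sided (fun s => t < s) t x e e0.
- by move=> s ts; rewrite gt_eqF.
- have gr : graininess T t = 0.
    apply/eqP; rewrite subr_eq0 eq_le fjump_ge andbT; apply/ler_addgt0Pl => d dp.
    have [s [Ts ts sd]] := acc _ dp; rewrite (le_trans (fjump_le Ts ts))//.
    by move: sd; rewrite gtr0_norm ?subr_gt0//; lra.
  have [/(_ gr) lim _] := fr _ Tt; exists (f t) => d dp.
  by have [d1 d10 h] := lim _ dp; exists d1 => // s Ts _; exact: h.
have [|f fr acc|d2 d20 h2] := @equicont_one_sided (fun s => s < t) t x e e0.
- by move=> s ts; rewrite lt_eqF.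
- have ld : left_dense T t.
    move=> d dp; have [s [Ts ts sd]] := acc _ dp; exists s; split=> //; split=> //.
    by move: sd; rewrite ltr0_norm ?subr_lt0//; lra.
  have [_ /(_ ld)[l hl]] := fr _ Tt; exists l => d dp.
  have [d1' d10' h] := hl _ dp; exists d1' => // s Ts st sd; apply: h => //.
  by move: sd; rewrite ltr0_norm ?subr_lt0//; lra.
exists (Num.min d0 (Num.min d1 d2)); first by rewrite !lt_min d00 d10.
move=> s y Ts; rewrite !lt_min => /and3P[_ s1 s2] /and3P[y0 y1 y2].
case: (ltgtP s t) => [st|ts|->]; [exact: h2|exact: h1|exact: h0].
Qed.

(** Counterexamples at radii tending to 0 have an ultralimit (t, x), with t in the closed set [T];
    [equicont_at] at that point, used once for each of the two arguments, contradicts them. *)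
Lemma unif_equicont (N r e : R) : @finite_dim R X -> 0 < e ->
  exists2 d : R, 0 < d & forall t x y, T t -> `|t| <= N -> `|x| <= r ->
    `|y - x| <= d -> `|a t y - a t x| <= e.
Proof.
move=> fd e0; apply: contrapT => H.
have bad (k : nat) : exists p : R * X * X, [/\ T p.1.1, `|p.1.1| <= N, `|p.1.2| <= r,
    `|p.2 - p.1.2| <= k.+1%:R^-1 & e < `|a p.1.1 p.2 - a p.1.1 p.1.2| ].
  apply: contrapT => H1; apply: H; exists k.+1%:R^-1; first by rewrite invr_gt0.
  move=> t x y Tt tN xr yx; rewrite leNgt; apply/negP => ey; apply: H1.
  by exists (t, x, y).
have [F hF] := choice bad.
have [U [UU oU]] := ultraFilterLemma (eventually_filter).
have [|t ht] := @ultra_lim_real R U UU (fun k => (F k).1.1) N.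
  by move=> k; have [] := hF k.
have [|x hx] := @ultra_lim R X U (fun k => (F k).1.2) r fd UU.
  by move=> k; have [] := hF k.
have Tt : T t.
  apply: closed_adherent => // d d0; have d2 : 0 < d / 2 by rewrite divr_gt0.
  have [k /= hk] := filter_ex (ht _ d2); exists (F k).1.1; split; first by have [] := hF k.
  by rewrite distrC (le_lt_trans hk)//; lra.
have e2 : 0 < e / 2 by rewrite divr_gt0.
have [d d0 hd] := equicont_at x Tt e2.
have d3 : 0 < d / 3 by rewrite divr_gt0.
have [n hn] := inv_succ_small d3.
have Un : U [set k : nat | (n <= k)%N] by apply: oU; exists n.
have [k /= [[tk xk] nk]] := filter_ex (filterI (filterI (ht _ d3) (hx _ d3)) Un).
have [Tk _ _ yk ek] := hF k.
have {}yk : `|(F k).2 - (F k).1.2| <= d / 3 by exact: le_trans yk (hn _ nk).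
have st : `|(F k).1.1 - t| < d by rewrite (le_lt_trans tk)//; lra.
have := hd _ (F k).1.2 Tk st _; rewrite (le_lt_trans xk) => [/(_ ltac:(lra)) h1|]; last lra.
have := hd _ (F k).2 Tk st _.
have := ler_distD (F k).1.2 (F k).2 x => h2.
rewrite (le_lt_trans h2) => [/(_ isT) h3|]; last lra.
have := ler_distD (a (F k).1.1 x) (a (F k).1.1 (F k).2) (a (F k).1.1 (F k).1.2).
rewrite (distrC (a _ x)); lra.
Qed.

End EquicontinuousNonlinearity.

(** * Partitions of unity and radial retraction *)

Section Weights.
Variables (R : realType) (X : normedModType R).

(** The estimate behind both normalisations below, the radial retraction and the weights of the
    partition of unity, whose denominators are maxima bounded below by a constant. *)
Lemma scale_inv_dist (x y : X) (p q c : R) : 0 < c -> c <= p -> c <= q -> `|y| <= q ->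
  `|p^-1 *: x - q^-1 *: y| <= c^-1 * (`|x - y| + `|q - p|).
Proof.
move=> c0 cp cq yq; have p0 : 0 < p by exact: lt_le_trans cp.
have q0 : 0 < q by exact: lt_le_trans cq.
have -> : p^-1 *: x - q^-1 *: y = p^-1 *: (x - y + ((q - p) / q) *: y).
  rewrite scalerDr scalerA mulrBl divff ?gt_eqF// scalerBr mulrBr mulr1 mulrA mulVf ?gt_eqF// mul1r.
  by rewrite scalerBl addrA subrK.
rewrite normrZ gtr0_norm ?invr_gt0//.
apply: ler_pM => //; [by rewrite invr_ge0 ltW|by rewrite lef_pV2|].
rewrite (le_trans (ler_normD _ _))// lerD2l normrZ normrM normfV (gtr0_norm q0).
by rewrite -mulrA -[leRHS]mulr1 ler_wpM2l// mulrC ler_pdivrMr// mul1r.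
Qed.

Lemma ler_dist_max (c a b : R) : `|Num.max c a - Num.max c b| <= `|a - b|.
Proof.
have := normr_ge0 (a - b); have := ler_norm (a - b); have := ler_norm (b - a).
rewrite (distrC b a) ler_norml.
by case: (leP c a) => h1; case: (leP c b) => h2; lra.
Qed.

Definition radial (r : R) (x : X) : X := r *: ((Num.max r `|x|)^-1 *: x).

Lemma radial_norm r x : 0 < r -> `|radial r x| <= r.
Proof.
move=> r0; have m0 : 0 < Num.max r `|x| by rewrite lt_max r0.
rewrite /radial !normrZ gtr0_norm// -[leRHS]mulr1 ler_pM2l//.
by rewrite gtr0_norm ?invr_gt0// mulrC ler_pdivrMr// mul1r le_max lexx orbT.
Qed.

Lemma radial_id r x : 0 < r -> `|x| <= r -> radial r x = x.
Proof. by move=> r0 xr; rewrite /radial max_l// scalerA divff ?scale1r// gt_eqF. Qed.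

Lemma radial_lipschitz r x y : 0 < r -> `|radial r x - radial r y| <= 2 * `|x - y|.
Proof.
move=> r0; rewrite /radial -scalerBr normrZ gtr0_norm//.
have := @scale_inv_dist x y (Num.max r `|x|) (Num.max r `|y|) r r0.
rewrite !le_max !lexx orbT => /(_ isT isT isT) h.
have h2 := le_trans (ler_dist_max r `|y| `|x|) (ler_dist_dist y x).
rewrite (distrC y x) in h2.
apply: le_trans (ler_wpM2l (ltW r0) h) _.
rewrite mulVKf ?gt_eqF//; lra.
Qed.

Lemma convex_norm_le (m : nat) (phi : 'I_m -> R) (z : 'I_m -> X) (c : R) : 0 <= c ->
  (forall i, 0 <= phi i) -> \sum_(i < m) phi i <= 1 ->
  (forall i, phi i != 0 -> `|z i| <= c) -> `|\sum_(i < m) phi i *: z i| <= c.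
Proof.
move=> c0 phi0 phi1 zc; rewrite (le_trans (ler_norm_sum _ _ _))//.
apply: (@le_trans _ _ (\sum_(i < m) phi i * c)).
  apply: ler_sum => i _; rewrite normrZ (ger0_norm (phi0 i)).
  have [->|/zc h] := eqVneq (phi i) 0; first by rewrite !mul0r.
  by rewrite ler_wpM2l.
by rewrite -mulr_suml -[leRHS]mul1r ler_wpM2r.
Qed.

End Weights.

(** Normalised tents, one per cell of width h, centred at a point of [T] in the cell if there is
    one. Dividing by [Num.max h (H s)] keeps the quotients Lipschitz where the tents do not cover. A
    point of [T] in [[- N, N]] shares its cell with some [p j], whose tent is at least del - h = h
    there, so the maximum is [H s]. *)
Lemma partition_of_unity (R : realType) (T : set R) (N del : R) : T !=set0 -> 0 < del ->
  exists (m : nat) (p : 'I_m -> R) (phi : 'I_m -> R -> R) (N' L : R),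
  [/\ forall i, T (p i),
   forall i s, 0 <= phi i s /\ (phi i s != 0 -> `|s - p i| < del /\ `|s| <= N'),
   forall s, \sum_(i < m) phi i s <= 1,
   forall s, T s -> `|s| <= N -> \sum_(i < m) phi i s = 1 &
   forall i s u, `|phi i s - phi i u| <= L * `|s - u|].
Proof.
move=> [t0 Tt0] del0; pose h := del / 2; have h0 : 0 < h by rewrite divr_gt0.
pose m := (Num.truncn (2 * N / h)).+1.
have cell (j : 'I_m) : exists q, T q /\ ((exists s, T s /\ j%:R * h <= s + N < j.+1%:R * h) ->
    j%:R * h <= q + N < j.+1%:R * h).
  have [[s [Ts sj]]|nex] := pselect (exists s, T s /\ j%:R * h <= s + N < j.+1%:R * h).
    by exists s.
  by exists t0.
have [p hp] := choice cell.
pose H s := \sum_(i < m) hat (p i) del s.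
pose q s := Num.max h (H s).
have hq s : h <= q s by rewrite le_max lexx.
have q0 s : 0 < q s by exact: lt_le_trans (hq s).
have hatH i s : hat (p i) del s <= H s.
  by rewrite /H (bigD1 i)//= lerDl sumr_ge0// => *; exact: hat_ge0.
have hat_q i s : hat (p i) del s <= q s by rewrite le_max hatH orbT.
exists m, p, (fun i s => hat (p i) del s / q s), (\sum_(i < m) `|p i| + del),
  (h^-1 * (1 + m%:R)); split.
- by move=> i; have [] := hp i.
- move=> i s; split; first by rewrite divr_ge0 ?hat_ge0// ltW.
  rewrite mulf_eq0 invr_eq0 (gt_eqF (q0 s)) orbF => n0.
  have : 0 < hat (p i) del s by rewrite lt_neqAle eq_sym n0 hat_ge0.
  rewrite hat_gt0 => sp; split=> //.
  have : `|p i| <= \sum_(i < m) `|p i| by rewrite (bigD1 i)//= lerDl sumr_ge0.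
  have := ler_normD (s - p i) (p i); rewrite subrK; lra.
- by move=> s; rewrite -mulr_suml ler_pdivrMr// mul1r le_max lexx orbT.
- move=> s Ts sN; rewrite -mulr_suml -/(H s).
  suff hH : h <= H s by rewrite /q max_r// divff// gt_eqF// (lt_le_trans h0).
  move: sN; rewrite ler_norml => /andP[sN1 sN2].
  have sN0 : 0 <= (s + N) / h by apply: divr_ge0; [lra|exact: ltW].
  have /andP[j1 j2] := truncn_itv sN0.
  have jm : (Num.truncn ((s + N) / h) < m)%N.
    rewrite /m ltnS; apply: le_truncn; rewrite ler_pM2r ?invr_gt0//; lra.
  pose j := Ordinal jm; have [Tp pj] := hp j.
  have sj : j%:R * h <= s + N < j.+1%:R * h.
    by rewrite -ler_pdivlMr// -ltr_pdivrMr// j1 j2.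
  have {}pj := pj (ex_intro _ s (conj Ts sj)).
  apply: le_trans (hatH j s); rewrite /hat le_max; apply/orP; right.
  have : `|s - p j| <= h.
    move: sj pj; rewrite -natr1 mulrDl mul1r ler_norml.
    set b := _ * h; move=> /andP[? ?] /andP[? ?]; lra.
  rewrite /h; lra.
- move=> i s u.
  have := @scale_inv_dist R R^o (hat (p i) del s) (hat (p i) del u) (q s) (q u) h h0 (hq s) (hq u).
  rewrite ger0_norm ?hat_ge0// => /(_ (hat_q i u)); rewrite /GRing.scale/= ![_^-1 * hat _ _ _]mulrC.
  move=> /le_trans; apply; rewrite -mulrA ler_pM2l ?invr_gt0//.
  rewrite mulrDl mul1r lerD ?hat_lipschitz//.
  rewrite (le_trans (ler_dist_max _ _ _))// /H -sumrB (le_trans (ler_norm_sum _ _ _))//.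
  apply: (@le_trans _ _ (\sum_(i < m) `|s - u|)).
    by apply: ler_sum => k _; rewrite distrC hat_lipschitz.
  by rewrite sumr_const card_ord mulr_natl.
Qed.

(** * Galerkin approximation *)

Section GreenOperator.
Variables (R : realType) (X : normedModType R) (T : set R).
Variables (Phi : R -> R -> {linear X -> X}) (P Q : R -> {linear X -> X}).

Lemma dantiderivB (f1 f2 G1 G2 : R -> X) : dantideriv T f1 G1 -> dantideriv T f2 G2 ->
  dantideriv T (fun s => f1 s - f2 s) (fun s => G1 s - G2 s).
Proof. by move=> h1 h2 t kt; apply: has_dderivB; [exact: h1|exact: h2]. Qed.

Lemma dintB (f1 f2 : R -> X) (b c : R) (v1 v2 : X) : dint T f1 b c v1 -> dint T f2 b c v2 ->
  dint T (fun s => f1 s - f2 s) b c (v1 - v2).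
Proof.
move=> [G1 [h1 ->]] [G2 [h2 ->]]; exists (fun s => G1 s - G2 s).
by split; [exact: dantiderivB|exact: subrACA].
Qed.

Lemma dist_subr_le (e : R) (u1 u2 v1 v2 : X) : `|u1 - v1| <= e / 2 -> `|u2 - v2| <= e / 2 ->
  `|u1 - u2 - (v1 - v2)| <= e.
Proof.
by move=> h1 h2; rewrite subrACA (le_trans (ler_normB _ _))// [leRHS]splitr lerD.
Qed.

Lemma dint_from_infB (f1 f2 : R -> X) (t : R) (v1 v2 : X) :
  dint_from_inf T f1 t v1 -> dint_from_inf T f2 t v2 ->
  dint_from_inf T (fun s => f1 s - f2 s) t (v1 - v2).
Proof.
rewrite /dint_from_inf; case: pselect => ?; first exact: dintB.
move=> [G1 [h1 l1]] [G2 [h2 l2]]; exists (fun s => G1 s - G2 s).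
split; first exact: dantiderivB.
move=> e e0; have e2 : 0 < e / 2 by rewrite divr_gt0.
have [N1 hN1] := l1 _ e2; have [N2 hN2] := l2 _ e2.
exists (Num.min N1 N2) => b Tb; rewrite lt_min => /andP[b1 b2].
rewrite [X in `|X - _|]subrACA; apply: dist_subr_le; [exact: hN1|exact: hN2].
Qed.

Lemma dint_to_supB (f1 f2 : R -> X) (t : R) (v1 v2 : X) :
  dint_to_sup T f1 t v1 -> dint_to_sup T f2 t v2 ->
  dint_to_sup T (fun s => f1 s - f2 s) t (v1 - v2).
Proof.
rewrite /dint_to_sup; case: pselect => ?; first exact: dintB.
move=> [G1 [h1 l1]] [G2 [h2 l2]]; exists (fun s => G1 s - G2 s).
split; first exact: dantiderivB.
move=> e e0; have e2 : 0 < e / 2 by rewrite divr_gt0.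
have [N1 hN1] := l1 _ e2; have [N2 hN2] := l2 _ e2.
exists (Num.max N1 N2) => b Tb; rewrite gt_max => /andP[b1 b2].
rewrite [X in `|X - _|]subrACA; apply: dist_subr_le; [exact: hN1|exact: hN2].
Qed.

Lemma LvalB (f1 f2 : R -> X) (t : R) (v1 v2 : X) :
  Lval T Phi P Q f1 t v1 -> Lval T Phi P Q f2 t v2 ->
  Lval T Phi P Q (fun s => f1 s - f2 s) t (v1 - v2).
Proof.
move=> [p1 [q1 [hp1 [hq1 ->]]]] [p2 [q2 [hp2 [hq2 ->]]]].
exists (p1 - p2), (q1 - q2); split; last split; last exact: subrACA.
  under [fun s => _]funext do rewrite !raddfB.
  exact: dint_from_infB.
under [fun s => _]funext do rewrite !raddfB.
exact: dint_to_supB.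
Qed.

Lemma rd_contB (f1 f2 : R -> X) : rd_cont T f1 -> rd_cont T f2 ->
  rd_cont T (fun s => f1 s - f2 s).
Proof.
move=> h1 h2 t Tt; have [c1 l1] := h1 t Tt; have [c2 l2] := h2 t Tt; split.
  move=> gr e e0; have e2 : 0 < e / 2 by rewrite divr_gt0.
  have [d1 d10 hd1] := c1 gr _ e2; have [d2 d20 hd2] := c2 gr _ e2.
  exists (Num.min d1 d2); first by rewrite lt_min d10.
  move=> s Ts; rewrite lt_min => /andP[s1 s2].
  by apply: dist_subr_le; [exact: hd1|exact: hd2].
move=> ld; have [v1 hv1] := l1 ld; have [v2 hv2] := l2 ld; exists (v1 - v2) => e e0.
have e2 : 0 < e / 2 by rewrite divr_gt0.
have [d1 d10 hd1] := hv1 _ e2; have [d2 d20 hd2] := hv2 _ e2.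
exists (Num.min d1 d2); first by rewrite lt_min d10.
move=> s Ts ds st; apply: dist_subr_le.
  by apply: hd1 => //; apply: le_lt_trans ds; rewrite lerB// ge_min lexx.
by apply: hd2 => //; apply: le_lt_trans ds; rewrite lerB// ge_min lexx orbT.
Qed.

(** [supnorm] is a real supremum and dominates the values of [g] only once [g] is known to be
    bounded. *)
Lemma Lbound_le (K M : R) (f g : R -> X) : 0 <= K -> Lbound T Phi P Q K -> rd_cont T f ->
  (forall t, T t -> Lval T Phi P Q f t (g t)) -> bounded_on T g ->
  (forall t, T t -> `|f t| <= M) -> forall t, T t -> `|g t| <= K * M.
Proof.
move=> K0 LK rf Lg [Mg gM] fM t Tt.
apply: (@le_trans _ _ (supnorm T g)).
  by apply: ub_le_sup; [exists Mg => _ [s Ts <-]; exact: gM|exists t].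
have bf : bounded_on T f by exists M.
rewrite (le_trans (LK _ bf rf _ Lg))// ler_wpM2l//.
by apply: ge_sup; [exists `|f t|, t|move=> _ [s Ts <-]; exact: fM].
Qed.

End GreenOperator.

Section Galerkin.
Variables (R : realType) (X : normedModType R) (T : set R).
Variables (A : R -> {linear X -> X}) (a : R -> X -> X).
Variables (Phi : R -> R -> {linear X -> X}) (P Q : R -> {linear X -> X}).
Variables (lambda0 beta0 K r M : R).
Hypothesis Tts : time_scale T.
Hypothesis fd : @finite_dim R X.
Hypothesis AM : forall t, T t -> forall x, `|A t x| <= M * `|x|.
Hypothesis M0 : 0 <= M.
Hypothesis a_rd : forall x : R -> X, cont_on T x -> rd_cont T (fun t => a t (x t)).
Hypothesis a_cont : forall t, T t -> continuous (a t).
Hypothesis hyp : hyperbolic T A Phi P Q.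
Hypothesis lambda0_ge0 : 0 <= lambda0.
Hypothesis beta0_ge0 : 0 <= beta0.
Hypothesis a_le : forall t x, T t -> `|a t x| <= lambda0 * `|x| + beta0.
Hypothesis K0 : 0 <= K.
Hypothesis LK : Lbound T Phi P Q K.
Hypothesis r0 : 0 < r.
Hypothesis Kr : K * (lambda0 * r + beta0) <= r.

Lemma galerkin (N e : R) : 0 < e -> exists x y : R -> X,
  [/\ forall t, T t -> `|x t| <= r, forall t, T t -> `|y t| <= r,
   dsolution T (fun t z => A t z + a t (y t)) x,
   forall s t, T s -> T t -> `|x t - x s| <= (M * r + (lambda0 * r + beta0)) * `|t - s| &
   forall t, T t -> `|t| <= N -> `|x t - y t| <= e].
Proof.
move=> e0; have [T0 Tcl] := Tts; have [_ _ _ hypL _] := hyp.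
set D := lambda0 * r + beta0; set C := M * r + D.
have D0 : 0 <= D by rewrite addr_ge0// mulr_ge0// ltW.
have C0 : 0 <= C by rewrite addr_ge0// mulr_ge0// ltW.
have C1 : 0 < C + 1 by lra.
(* One value of [L] is fixed for each f; unless f is bounded and rd-continuous, [L f] is the dummy
   value f. *)
have /choice[L hL] : forall f : R -> X, exists g : R -> X,
    bounded_on T f -> rd_cont T f ->
    [/\ forall t, T t -> Lval T Phi P Q f t (g t),
     dsolution T (fun t y => A t y + f t) g & bounded_on T g].
  move=> f.
  have [[bf rf]|nf] := pselect (bounded_on T f /\ rd_cont T f).
    by have [g [? [? ?]]] := hypL f bf rf; exists g.
  by exists f => bf rf; case: nf.
have LD (f1 f2 : R -> X) (h : R) : bounded_on T f1 -> rd_cont T f1 ->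
    bounded_on T f2 -> rd_cont T f2 ->
    (forall t, T t -> `|f1 t - f2 t| <= h) ->
    forall t, T t -> `|L f1 t - L f2 t| <= K * h.
  move=> b1 r1 b2 r2; apply: Lbound_le K0 LK (rd_contB r1 r2) _ _.
    by move=> t Tt; apply: LvalB; [have [+ _ _] := hL _ b1 r1|have [+ _ _] := hL _ b2 r2]; apply.
  have [_ _ [B1 hB1]] := hL _ b1 r1; have [_ _ [B2 hB2]] := hL _ b2 r2.
  exists (B1 + B2) => t Tt; rewrite (le_trans (ler_normB _ _))// lerD ?hB1 ?hB2//.
(* Over a distance del a function with Lipschitz constant C varies by at most e / 2; the added 1
   avoids division by 0. *)
pose del := e / 2 / (C + 1); have del0 : 0 < del by rewrite !divr_gt0.
have [m [p [phi [N' [LL [Tp phiP phi1 phiT phiL]]]]]] := partition_of_unity N T0 del0.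
have phi0 i s : 0 <= phi i s by have [] := phiP i s.
have [n [b [k [B [B0 kb kB]]]]] := finite_dim_coord fd.
(* [B * r] bounds the coordinates of every vector of norm at most r, so an affine map brings them
   into [[0, 1]]. *)
have W0 : 0 < B * r by rewrite mulr_gt0.
set W := B * r in W0.
pose E := 1 + \sum_(i < n) `|b i|.
have E0 : 0 < E by rewrite ltr_wpDr// sumr_ge0.
pose I := ('I_m * 'I_n)%type.
pose vec (u : I -> R) j := \sum_(i < n) (2 * W * u (j, i) - W) *: b i.
(* Coordinates in the cube may describe a vector longer than r; the retraction restores the a priori
   bound and fixes the vectors already within it. *)
pose cu u j := radial r (vec u j).
pose yu u s := \sum_(j < m) phi j s *: cu u j.
pose fu u s := a s (yu u s).
(* A fixed point u of [G] encodes the samples of [L (fu u)] itself at the nodes. *)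
pose G u (ji : I) := k (L (fu u) (p ji.1)) ji.2 / (2 * W) + 1 / 2.
have cur u j : `|cu u j| <= r by exact: radial_norm.
have yur u s : `|yu u s| <= r by apply: convex_norm_le => //; exact: ltW.
have yuL u s t : `|yu u s - yu u t| <= (m%:R * (LL * r)) * `|s - t|.
  rewrite /yu -sumrB (le_trans (ler_norm_sum _ _ _))//.
  rewrite (le_trans (_ : _ <= \sum_(j < m) LL * `|s - t| * r))//.
    apply: ler_sum => j _; rewrite -scalerBl normrZ; apply: ler_pM => //; exact: phiL.
  by rewrite sumr_const card_ord -mulr_natl; lra.
have yuc u : cont_on T (yu u).
  move=> t _ d d0; set L' := m%:R * (LL * r) in yuL.
  have L0 : 0 < `|L'| + 1 by rewrite ltr_wpDl.
  exists (d / (`|L'| + 1)) => [|s _]; first by rewrite divr_gt0.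
  rewrite ltr_pdivlMr// => sd; rewrite (le_trans (yuL u s t))//.
  rewrite (le_trans _ (ltW sd))// mulrC ler_wpM2l//.
  by rewrite (le_trans (ler_norm _))// lerDl.
have fur u : rd_cont T (fu u) by exact: a_rd.
have fuD u s : T s -> `|fu u s| <= D.
  by move=> Ts; rewrite (le_trans (a_le _ Ts))// lerD2r ler_wpM2l.
have fub u : bounded_on T (fu u) by exists D => s; exact: fuD.
have xur u s : T s -> `|L (fu u) s| <= r.
  have [Lv _ Lb] := hL _ (fub u) (fur u).
  move=> Ts; apply: le_trans Kr; apply: Lbound_le K0 LK (fur u) Lv Lb _ _ Ts.
  exact: fuD.
have xuL u s t : T s -> T t -> `|L (fu u) t - L (fu u) s| <= C * `|t - s|.
  have [_ Ls _] := hL _ (fub u) (fur u).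
  apply: (dderiv_lipschitz Tcl C0 Ls) => v Tv.
  rewrite (le_trans (ler_normD _ _))// lerD ?fuD// (le_trans (AM Tv _))//.
  by rewrite ler_wpM2l// xur.
have G01 u : (forall i, 0 <= u i <= 1) -> forall i, 0 <= G u i <= 1.
  move=> _ [j i]; rewrite /G /=.
  have : `|k (L (fu u) (p j)) i| <= W.
    by rewrite (le_trans (kB _ i))// -kb ler_wpM2l ?xur// ltW.
  have W2 : 0 < 2 * W by rewrite mulr_gt0.
  rewrite ler_norml => /andP[k1 k2]; apply/andP; split.
    rewrite -lerBlDr sub0r ler_pdivlMr//; lra.
  rewrite -lerBrDr ler_pdivrMr//; lra.
have vecL u v (d : R) j : 0 <= d -> (forall i, `|u (j, i) - v (j, i)| <= d) ->
    `|vec u j - vec v j| <= 2 * W * d * E.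
  move=> d0 uv; rewrite /vec -sumrB (le_trans (ler_norm_sum _ _ _))//.
  rewrite /E mulrDr mulr1 ler_wpDl//; first by rewrite !mulr_ge0// ltW.
  rewrite mulr_sumr; apply: ler_sum => i _; rewrite -scalerBl normrZ ler_wpM2r//.
  rewrite (_ : _ - _ = 2 * W * (u (j, i) - v (j, i))); last by ring.
  by rewrite normrM gtr0_norm ?mulr_gt0// ler_pM2l ?mulr_gt0.
have Guc (e1 : R) : 0 < e1 -> exists2 d : R, 0 < d & forall u v : I -> R,
     (forall i, 0 <= u i <= 1) -> (forall i, 0 <= v i <= 1) ->
     (forall i, `|u i - v i| <= d) -> forall i, `|G u i - G v i| <= e1.
  move=> e10; have BK : 0 < B * K + 1 by rewrite ltr_wpDl// mulr_ge0// ltW.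
  pose eta := 2 * W * e1 / (B * K + 1).
  have eta0 : 0 < eta by rewrite !(divr_gt0, mulr_gt0).
  have [d d0 hd] := unif_equicont a_rd a_cont Tcl N' r fd eta0.
  pose d' := d / (2 * (2 * W * E)).
  have d'0 : 0 < d' by rewrite divr_gt0// !mulr_gt0.
  exists d' => // u v _ _ uv [j i].
  (* Every [yu w] vanishes off [[- N', N']], so the two right-hand sides agree outside and
     equicontinuity is needed only inside. *)
  have fuv t : T t -> `|fu u t - fu v t| <= eta.
    move=> Tt; have [tN|Nt] := leP `|t| N'; last first.
      have z w : yu w t = 0.
        rewrite /yu big1// => l _; suff -> : phi l t = 0 by rewrite scale0r.
        by apply/eqP; apply: contraT => /(proj2 (phiP l t))[_]; rewrite leNgt Nt.
      by rewrite /fu !z subrr normr0 ltW.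
    apply: hd => //; rewrite /yu -sumrB.
    under eq_bigr do rewrite -scalerBr.
    apply: convex_norm_le => // [|l _]; first exact: ltW.
    rewrite (le_trans (radial_lipschitz _ _ r0))//.
    have vl := vecL u v d' l (ltW d'0) (fun i => uv (l, i)).
    have dE : d' * (2 * (2 * W * E)) = d by rewrite /d' divfK// gt_eqF// !mulr_gt0.
    lra.
  have := LD _ _ _ (fub u) (fur u) (fub v) (fur v) fuv (p j) (Tp j).
  move=> Luv; rewrite /G/= opprD addrACA subrr addr0 -mulrBl normrM.
  rewrite [X in _ * X]gtr0_norm ?invr_gt0 ?mulr_gt0// ler_pdivrMr ?mulr_gt0//.
  have := kB (fun l => k (L (fu u) (p j)) l - k (L (fu v) (p j)) l) i.
  under eq_bigr do rewrite scalerBl.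
  rewrite sumrB -!kb => /le_trans; apply.
  rewrite (le_trans (ler_wpM2l (ltW B0) Luv))//.
  have etaE : eta * (B * K + 1) = 2 * W * e1 by rewrite /eta divfK// gt_eqF.
  rewrite [leRHS]mulrC -etaE; lra.
(* An error e2 in [G] becomes at most 2 W E e2 in the vectors and at most doubles under the
   retraction, which gives e / 2. *)
pose e2 := e / (8 * W * E); have e20 : 0 < e2 by rewrite divr_gt0// !mulr_gt0.
have [u [_ uG]] := approx_brouwer G01 Guc e20.
have [Lv Ls Lb] := hL _ (fub u) (fur u).
exists (L (fu u)), (yu u); split=> //; first by move=> t; exact: xur.
  by move=> s t; exact: xuL.
have close j : `|L (fu u) (p j) - cu u j| <= e / 2.
  rewrite -(radial_id r0 (xur u (p j) (Tp j))) /cu.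
  rewrite (le_trans (radial_lipschitz _ _ r0))//.
  pose v : I -> R := fun ji => G u ji.
  have -> : L (fu u) (p j) = vec v j.
    rewrite {1}(kb (L (fu u) (p j))); apply: eq_bigr => i _; congr (_ *: _).
    rewrite /v /G/= mulrDr mulrCA divff ?gt_eqF ?mulr_gt0// mulr1; lra.
  have vl := vecL v u e2 j (ltW e20) (fun i => uG (j, i)).
  have : e2 * (8 * W * E) = e by rewrite /e2 divfK// gt_eqF// !mulr_gt0.
  lra.
move=> t Tt tN.
(* Since the weights sum to 1 here, the error is an average over nodes within del of t: e / 2 from
   the Lipschitz bound and e / 2 from the sampling error. *)
have -> : L (fu u) t - yu u t = \sum_(j < m) phi j t *: (L (fu u) t - cu u j).
  under eq_bigr do rewrite scalerBr.
  by rewrite sumrB -scaler_suml phiT// scale1r.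
apply: convex_norm_le => // [|j /(proj2 (phiP j t))[tp _]]; first exact: ltW.
have := ler_distD (L (fu u) (p j)) (L (fu u) t) (cu u j).
have := close j; have := xuL u (p j) t (Tp j) Tt.
have : C * `|t - p j| <= (C + 1) * del.
  by apply: ler_pM => //; [lra|exact: ltW].
have : del * (C + 1) = e / 2 by rewrite /del divfK// gt_eqF.
lra.
Qed.

End Galerkin.

(** * Passage to the limit *)

(** The norm is an infimum, so the strict inequality leaves room for an admissible [K]. For lambda =
    0, where division is impossible, any admissible [K] serves. *)
Lemma Lopnorm_witness (R : realType) (X : normedModType R) (T : set R)
  (Phi : R -> R -> {linear X -> X}) (P Q : R -> {linear X -> X}) (lambda : R) :
  (exists K, 0 <= K /\ Lbound T Phi P Q K) -> 0 <= lambda ->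
  lambda * Lopnorm T Phi P Q < 1 ->
  exists K, [/\ 0 <= K, Lbound T Phi P Q K & lambda * K < 1].
Proof.
move=> [K1 [K10 LK1]]; rewrite le_eqVlt => /predU1P[<- _|l0 l1].
  by exists K1; rewrite mul0r ltr01.
have hi : has_inf [set K | 0 <= K /\ Lbound T Phi P Q K].
  by split; [exists K1|exists 0; move=> K []].
have d0 : 0 < lambda^-1 - Lopnorm T Phi P Q.
  by rewrite subr_gt0 -[_^-1]mulr1 ltr_pdivlMl.
have [K [K0 LK]] := inf_adherent d0 hi; rewrite -/(Lopnorm T Phi P Q) subrKC => Kl.
by exists K; split=> //; rewrite -ltr_pdivlMl// mulr1.
Qed.

Section UltraLimitSolution.
Variables (R : realType) (X : normedModType R) (T : set R).
Variables (A : R -> {linear X -> X}) (a : R -> X -> X) (M C : R).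
Hypothesis Tcl : closed T.
Hypothesis A_rd : op_rd_cont T A.
Hypothesis a_rd : forall x : R -> X, cont_on T x -> rd_cont T (fun t => a t (x t)).
Hypothesis a_cont : forall t, T t -> continuous (a t).
Hypothesis AM : forall t, T t -> forall x, `|A t x| <= M * `|x|.
Hypothesis M0 : 0 <= M.
Hypothesis C0 : 0 <= C.
Variables (U : set_system nat) (xn yn : nat -> R -> X) (x : R -> X).
Hypothesis UU : UltraFilter U.
Hypothesis oU : \oo `<=` U.
Hypothesis xn_sol : forall n, dsolution T (fun t z => A t z + a t (yn n t)) (xn n).
Hypothesis xnC : forall n s t, T s -> T t -> `|xn n t - xn n s| <= C * `|t - s|.
Hypothesis xyn : forall n t, T t -> `|t| <= n%:R -> `|xn n t - yn n t| <= n.+1%:R^-1.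
Hypothesis xlim : forall t, T t -> forall e : R, 0 < e -> U [set n | `|xn n t - x t| <= e].

Let dn n s := A s (xn n s) + a s (yn n s).
Let F t := A t (x t) + a t (x t).

Lemma ultra_limit_lipschitz s t : T s -> T t -> `|x t - x s| <= C * `|t - s|.
Proof.
move=> Ts Tt; apply/ler_addgt0Pl => e e0; have e2 : 0 < e / 2 by rewrite divr_gt0.
have [n /= [h1 h2]] := filter_ex (filterI (xlim Ts e2) (xlim Tt e2)).
have := xnC n Ts Tt; rewrite distrC in h2.
have := ler_distD (xn n t) (x t) (x s); have := ler_distD (xn n s) (xn n t) (x s); lra.
Qed.

(** At a right-dense t the mean value inequality requires control of [dn n s] in a whole
    neighbourhood; at a right-scattered t only s = t is needed, and from the left rd-continuity
    gives no comparison with the value at t. The common Lipschitz constant makes one set of indices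
    serve all s. *)
Lemma ultra_limit_rhs t (e : R) : T t -> 0 < e ->
  exists2 d : R, 0 < d & U [set n | forall s, T s -> `|s - t| < d ->
    graininess T t = 0 \/ s = t -> `|dn n s - F t| <= e].
Proof.
move=> Tt e0; have e4 : 0 < e / 4 by rewrite divr_gt0.
have [d1 d10 hd1] := equicont_at a_rd a_cont (x t) Tt e4.
have [d2 d20 hd2] : exists2 d : R, 0 < d & forall s, T s -> `|s - t| < d ->
    graininess T t = 0 \/ s = t -> `|a s (x t) - a t (x t)| <= e / 4.
  have [gr|gr] := pselect (graininess T t = 0).
    have cst : cont_on T (fun=> x t).
      by move=> u _ d d0; exists 1 => // v _ _; rewrite subrr normr0 ltW.
    have [/(_ gr _ e4)[d d0 hd] _] := a_rd cst Tt.
    by exists d => // s Ts sd _; exact: hd.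
  by exists 1 => // s _ _ [//|->]; rewrite subrr normr0 ltW.
have x10 : 0 < `|x t| + 1 by rewrite ltr_wpDl.
have e'0 : 0 < e / 4 / (`|x t| + 1) by rewrite divr_gt0.
have [d3 d30 hd3] : exists2 d : R, 0 < d & forall s, T s -> `|s - t| < d ->
    graininess T t = 0 \/ s = t -> `|A s (x t) - A t (x t)| <= e / 4.
  have [gr|gr] := pselect (graininess T t = 0).
    have [/(_ gr _ e'0)[d d0 hd] _] := A_rd Tt.
    exists d => // s Ts sd _; rewrite (le_trans (hd s Ts sd _))//.
    by rewrite -[leRHS]mulr1 -mulrA ler_pM2l// mulrC ler_pdivrMr// mul1r lerDl.
  by exists 1 => // s _ _ [//|->]; rewrite subrr normr0 ltW.
have M1 : 0 < M + 1 by rewrite ltr_wpDl.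
have C1 : 0 < C + 1 by rewrite ltr_wpDl.
(* q will bound [|xn n s - x t|]: M q is at most e / 4, and with d1 / 2 allowed for
   [|xn n s - yn n s|] the point [yn n s] stays within d1 of [x t]. *)
pose q := Num.min (d1 / 4) (e / 4 / (M + 1)).
have q0 : 0 < q by rewrite lt_min !divr_gt0.
have qd1 : q <= d1 / 4 by rewrite ge_min lexx.
have qM : M * q <= e / 4.
  have : q <= e / 4 / (M + 1) by rewrite ge_min lexx orbT.
  rewrite (ler_pdivlMr _ _ M1); have := ltW q0; lra.
pose d4 := q / 2 / (C + 1); have d40 : 0 < d4 by rewrite !divr_gt0.
have d4q : d4 * (C + 1) = q / 2 by rewrite divfK// gt_eqF.
exists (Num.min (Num.min d1 d2) (Num.min d3 (Num.min 1 d4))).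
  by rewrite !lt_min d10 d20 d30 ltr01.
have q2 : 0 < q / 2 by rewrite divr_gt0.
have d12 : 0 < d1 / 2 by rewrite divr_gt0.
have [n0 hn0] := inv_succ_small d12.
have [n1 [n01 tn1]] : exists n1, (n0 <= n1)%N /\ `|t| + 1 <= n1%:R.
  exists (n0 + (Num.truncn (`|t| + 1)%R).+1)%N; split; first exact: leq_addr.
  by rewrite (le_trans (ltW (truncnS_gt _)))// ler_nat leq_addl.
have Un : U [set n | (n1 <= n)%N] by apply: oU; exists n1.
apply: filterS (filterI (xlim Tt q2) Un) => n /= [xt nn] s Ts.
rewrite !lt_min => /andP[/andP[sd1 sd2] /and3P[sd3 s1 sd4]] gs.
have sn : `|s| <= n%:R.
  apply: (@le_trans _ _ (`|t| + 1)).
    by have := ler_normD (s - t) t; rewrite subrK; lra.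
  by rewrite (le_trans tn1)// ler_nat.
have xs : `|xn n s - x t| <= q.
  have := xnC n Tt Ts; have := ler_distD (xn n t) (xn n s) (x t).
  have : C * `|s - t| <= (C + 1) * d4 by apply: ler_pM => //; [lra|exact: ltW].
  lra.
have ys : `|yn n s - x t| < d1.
  have h1 := xyn Ts sn; rewrite distrC in h1.
  have h2 := le_trans h1 (hn0 n (leq_trans n01 nn)).
  have h3 := ler_distD (xn n s) (yn n s) (x t).
  apply: le_lt_trans h3 _; apply: (@le_lt_trans _ _ (d1 / 2 + d1 / 4)); last first.
    by move: d10; lra.
  by rewrite lerD// (le_trans xs).
have a1 := hd1 _ _ Ts sd1 ys; have a2 := hd2 _ Ts sd2 gs; have a3 := hd3 _ Ts sd3 gs.
have a4 : `|A s (xn n s) - A s (x t)| <= e / 4.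
  by rewrite -raddfB (le_trans (AM Ts _))// (le_trans _ qM)// ler_wpM2l.
rewrite /dn /F opprD addrACA (le_trans (ler_normD _ _))//.
have := ler_distD (A s (x t)) (A s (xn n s)) (A t (x t)).
have := ler_distD (a s (x t)) (a s (yn n s)) (a t (x t)); lra.
Qed.

(** At a right-dense point the mean value inequality for [xn n] with slope [v] passes to the limit.
    At a right-scattered point the equation fixes the increment [x (fjump T t) - x t], a pointwise
    limit, and the Lipschitz bound on [x] does the rest. *)
Lemma ultra_limit_solution : dsolution T (fun t z => A t z + a t z) x.
Proof.
move=> t kt; have [Tt _] := kt; rewrite -/(F t); set v := F t => e e0.
have v0 := normr_ge0 v.
have lim_le s s' w c : T s -> T s' ->
    (forall h : R, 0 < h -> exists2 E : set nat, U E &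
       forall n, E n -> `|xn n s' - xn n s - w| <= c + h) -> `|x s' - x s - w| <= c.
  move=> Ts Ts' hE; apply/ler_addgt0Pl => h h0; have h3 : 0 < h / 3 by rewrite divr_gt0.
  have [E UE hn] := hE _ h3.
  have [n [/= [h1 h2] /hn h4]] := filter_ex (filterI (filterI (xlim Ts h3) (xlim Ts' h3)) UE).
  have -> : x s' - x s - w = (xn n s' - xn n s - w) - (xn n s' - x s' - (xn n s - x s)).
    rewrite [X in _ = _ - X]subrACA [RHS](subrACA _ w).
    by rewrite subrr sub0r opprB.
  rewrite (le_trans (ler_normB _ _))//.
  have := ler_normB (xn n s' - x s') (xn n s - x s); lra.
have [gr|] := eqVneq (graininess T t) 0.
  have jt : fjump T t = t by apply/eqP; rewrite -subr_eq0; apply/eqP.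
  have [d d0 Ud] := ultra_limit_rhs Tt e0; exists d => // s Ts sd; rewrite jt.
  apply: lim_le => // h h0; eexists; first exact: Ud.
  move=> n /= hn; apply: ler_wpDr; first exact: ltW.
  have /orP[st|ts] := le_total s t.
    rewrite ger0_norm ?subr_ge0//.
    apply: (@dderiv_mean_value _ _ _ Tcl (xn n) (dn n) s t e v (ltW e0) Ts Tt st
      (@xn_sol n)) => u Tu su ut.
    apply: hn => //; last by left.
    by move: sd; rewrite ger0_norm ?subr_ge0// ltr0_norm ?subr_lt0//; lra.
  rewrite (distrC t s) ger0_norm ?subr_ge0//.
  have mv : `|xn n s - xn n t - (s - t) *: v| <= e * (s - t).
    apply: (@dderiv_mean_value _ _ _ Tcl (xn n) (dn n) t s e v (ltW e0) Tt Ts ts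
      (@xn_sol n)) => u Tu tu us; apply: hn => //; last by left.
    by move: sd; rewrite distrC !ger0_norm ?subr_ge0//; lra.
  rewrite -normrN (_ : - (xn n t - xn n s - (t - s) *: v) = xn n s - xn n t - (s - t) *: v)//.
  by rewrite !opprB addrC -(opprB s t) scaleNr.
set mu := fjump T t - t => mu_neq0.
have mu0 : 0 < mu by rewrite lt_neqAle eq_sym mu_neq0 subr_ge0 fjump_ge.
have Tj := fjump_in Tcl Tt.
have step : x (fjump T t) - x t - mu *: v = 0.
  apply/eqP; rewrite -normr_le0; apply: lim_le => // h h0; rewrite add0r.
  have hm : 0 < h / 2 / mu by rewrite !divr_gt0.
  have [d d0 Ud] := ultra_limit_rhs Tt hm; eexists; first exact: Ud.
  move=> n /= hn; have := hn t Tt; rewrite subrr normr0 => /(_ d0 (or_intror erefl)) h1.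
  have [d' d'0 hd'] := @xn_sol n _ kt _ hm.
  have := hd' t Tt; rewrite subrr normr0 => /(_ d'0); rewrite -/mu (gtr0_norm mu0) divfK ?gt_eqF//.
  rewrite -/(dn n t) => h2.
  have -> : xn n (fjump T t) - xn n t - mu *: v =
      (xn n (fjump T t) - xn n t - mu *: dn n t) + mu *: (dn n t - v).
    by rewrite scalerBr addrA subrK.
  rewrite (le_trans (ler_normD _ _))// normrZ (gtr0_norm mu0) [leRHS]splitr lerD//.
  by rewrite mulrC -ler_pdivlMr.
have c0 : 0 < C + `|v| + 1 by have := C0; lra.
(* For [|t - s|] below mu / 2 the distance from s to [fjump T t] is at least mu / 2, so the
   tolerance is at least e mu / 2 and absorbs [(C + |v|) |t - s|]. *)
exists (Num.min (mu / 2) (e * (mu / 2) / (C + `|v| + 1))).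
  by rewrite lt_min !(divr_gt0, mulr_gt0).
move=> s Ts; rewrite lt_min => /andP[s1 s2].
have -> : x (fjump T t) - x s - (fjump T t - s) *: v =
    (x (fjump T t) - x t - mu *: v) + (x t - x s - (t - s) *: v).
  rewrite (_ : fjump T t - s = mu + (t - s)); last by rewrite /mu; ring.
  by rewrite scalerDl opprD [RHS]addrACA subrKA.
rewrite step add0r (le_trans (ler_normB _ _))// normrZ.
have xc := ultra_limit_lipschitz Ts Tt.
apply: (@le_trans _ _ (e * (mu / 2))); last first.
  rewrite ler_pM2l// (le_trans _ (ler_norm _))//.
  have : t - s >= - `|t - s| by rewrite lerNl -normrN ler_norm.
  by rewrite -[fjump T t](subrK t) -/mu; lra.
move: s2; rewrite ltr_pdivlMr//; have := normr_ge0 (t - s); lra.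
Qed.

End UltraLimitSolution.

Theorem mainTheorem3 (R : realType) (X : normedModType R) (T : set R)
  (A : R -> {linear X -> X}) (a : R -> X -> X)
  (Phi : R -> R -> {linear X -> X}) (P Q : R -> {linear X -> X})
  (lambda0 beta0 : R) :
  time_scale T ->
  @finite_dim R X ->
  (exists M : R, forall t, T t -> forall x, `|A t x| <= M * `|x|) ->
  op_rd_cont T A ->
  (forall x : R -> X, cont_on T x -> rd_cont T (fun t => a t (x t))) ->
  (forall t, T t -> continuous (a t)) ->
  cauchy_op T A Phi ->
  hyperbolic T A Phi P Q ->
  0 <= lambda0 -> 0 <= beta0 ->
  (forall t x, T t -> `|a t x| <= lambda0 * `|x| + beta0) ->
  lambda0 * Lopnorm T Phi P Q < 1 ->
  exists x : R -> X, bounded_on T x /\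
    dsolution T (fun t y => A t y + a t y) x.
Proof.
move=> Tts fd [M' AM'] A_rd a_rd a_cont _ hyp l0 b0 a_le lL.
have [_ _ _ _ exK] := hyp.
have [K [K0 LK lK]] := Lopnorm_witness exK l0 lL.
have M0 := normr_ge0 M'; set M := `|M'| in M0.
have AM t : T t -> forall x, `|A t x| <= M * `|x|.
  by move=> Tt x; rewrite (le_trans (AM' _ Tt x))// ler_wpM2r// ler_norm.
have lK1 : 0 < 1 - lambda0 * K by rewrite subr_gt0.
(* The solution of [K * (lambda0 * r + beta0) + 1 = r]; the 1 keeps r positive even when [K * beta0]
   is 0. *)
pose r := (K * beta0 + 1) / (1 - lambda0 * K).
have r0 : 0 < r by rewrite divr_gt0// ltr_wpDl// mulr_ge0.
have Kr : K * (lambda0 * r + beta0) <= r.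
  have : r * (1 - lambda0 * K) = K * beta0 + 1 by rewrite /r divfK// gt_eqF.
  lra.
pose C := M * r + (lambda0 * r + beta0).
have C0 : 0 <= C by rewrite !addr_ge0// mulr_ge0// ltW.
have gal (n : nat) : exists p : (R -> X) * (R -> X),
    [/\ forall t, T t -> `|p.1 t| <= r,
     dsolution T (fun t z => A t z + a t (p.2 t)) p.1,
     forall s t, T s -> T t -> `|p.1 t - p.1 s| <= C * `|t - s| &
     forall t, T t -> `|t| <= n%:R -> `|p.1 t - p.2 t| <= n.+1%:R^-1].
  have n0 : 0 < n.+1%:R^-1 :> R by rewrite invr_gt0.
  have [x [y [h1 _ h2 h3 h4]]] :=
    galerkin Tts fd AM M0 a_rd a_cont hyp l0 b0 a_le K0 LK r0 Kr n%:R n0.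
  by exists (x, y).
have [p hp] := choice gal.
have [U [UU oU]] := ultraFilterLemma (eventually_filter).
have /choice[x hx] : forall t, exists l, T t -> forall e : R, 0 < e ->
    U [set n | `|(p n).1 t - l| <= e].
  move=> t; have [Tt|nTt] := pselect (T t); last by exists 0.
  have [|l hl] := @ultra_lim R X U (fun n => (p n).1 t) r fd UU.
    by move=> n; have [h _ _ _] := hp n; exact: h.
  by exists l.
exists x; split.
  exists (r + 1) => t Tt; have [n /= h1] := filter_ex (hx t Tt _ ltr01).
  have [h2 _ _ _] := hp n; have := h2 _ Tt; rewrite distrC in h1.
  have := ler_normD (x t - (p n).1 t) ((p n).1 t); rewrite subrK; lra.
apply: (@ultra_limit_solution _ _ _ _ _ M C _ _ _ _ _ _ _ U
  (fun n => (p n).1) (fun n => (p n).2)) => //; first by case: Tts.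
- by move=> n; have [] := hp n.
- by move=> n s t; have [_ _ h _] := hp n; exact: h.
- by move=> n t; have [_ _ _ h] := hp n; exact: h.
Qed.
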